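(* Let $G$ be a finite multigraph admitting a nowhere-zero $3$-flow. Then $G$ is facially $3$-colorable, i.e., every drawing of $G$ in the plane admits a face-$3$-coloring.
   Context: Multigraphs may have loops and parallel edges. A nowhere-zero $k$-flow on $G$ is a pair $(D,f)$ where $D$ is an orientation of $G$ and $f:A(D)\to\mathbb{Z}_k\setminus\{0\}$ satisfies, for every vertex $v$, $\sum_{(w,v)\in A(D)}f(e)=\sum_{(v,w)\in A(D)}f(e)$ in $\mathbb{Z}_k$. A drawing of $G$ maps vertices to distinct points of $\mathbb{R}^2$ and each edge to a continuous curve joining the images of its endpoints (closed curve for a loop) containing no other vertex images; edges may self-intersect and intersect each other, with finitely many intersection points. Faces are the connected components of $\mathbb{R}^2\setminus\Gamma$; two faces are adjacent if they share a common segment of an edge (a face may be adjacent to itself). A face-$k$-coloring is a map from faces to $\{0,\dots,k-1\}$ giving adjacent faces different colors. $G$ is facially $3$-colorable if every drawing of $G$ has a face-$3$-coloring. *)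

(* Defs.v *)
From HB Require Import structures.
From mathcomp Require Import all_boot all_order all_algebra.
From mathcomp Require Import all_classical all_reals all_analysis.
Import Order.TTheory GRing.Theory Num.Theory.
Import numFieldNormedType.Exports.

Set Implicit Arguments.
Unset Strict Implicit.
Unset Printing Implicit Defensive.

Local Open Scope classical_set_scope.
Local Open Scope ring_scope.

(* An edge has an unordered pair of ends: which of the two is called [end0]   *)
(* carries no meaning. Loops are the edges with [end0 e = end1 e].            *)
Record multigraph := Multigraph {
  vertex : finType;
  edge : finType;
  end0 : edge -> vertex;
  end1 : edge -> vertex
}.

Section Flow.
Variable G : multigraph.

(* [o e = false] directs [e] from [end0 e] to [end1 e].                       *)
Definition orientation := edge G -> bool.
Definition arc_tail (o : orientation) (e : edge G) : vertex G :=
  if o e then end1 e else end0 e.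
Definition arc_head (o : orientation) (e : edge G) : vertex G :=
  if o e then end0 e else end1 e.

(* Meaningful for [1 < k] only, since ['Z_0] and ['Z_1] are ['Z_2].           *)
Definition nowhere_zero_flow (k : nat) (o : orientation) (f : edge G -> 'Z_k) :=
  (forall e, f e != 0) /\
  (forall v, \sum_(e | arc_head o e == v) f e = \sum_(e | arc_tail o e == v) f e).

Definition has_nowhere_zero_flow (k : nat) :=
  exists (o : orientation) (f : edge G -> 'Z_k), nowhere_zero_flow o f.
End Flow.

(* Only the values of [curve e] on [0, 1] matter. The last field says that    *)
(* finitely many points of the plane are attained twice, by two edges or by   *)
(* two parameters on one edge. Ends shared by several edges are attained      *)
(* twice as well, but there are finitely many of them.                        *)
Record drawing (R : realType) (G : multigraph) := Drawing {
  pos : vertex G -> R * R;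
  curve : edge G -> R -> R * R;
  pos_inj : injective pos;
  curve_continuous : forall e, {within `[0, 1], continuous (curve e)};
  curve0 : forall e, curve e 0 = pos (end0 e);
  curve1 : forall e, curve e 1 = pos (end1 e);
  curve_avoids : forall e v (t : R), `[0, 1]%classic t -> curve e t = pos v ->
    v = end0 e \/ v = end1 e;
  finite_crossings : finite_set [set x : R * R |
    exists e (s : R) e' (t : R),
      [/\ `[0, 1]%classic s, `[0, 1]%classic t, (e, s) <> (e', t),
      curve e s = x & curve e' t = x]]
}.

Definition components (T : topologicalType) (A : set T) : set (set T) :=
  connected_component A @` A.

Section Faces.
Variables (R : realType) (G : multigraph) (D : drawing R G).

Definition drawn : set (R * R) :=
  range (pos D) `|` \bigcup_(e in setT) (curve D e @` `[0, 1]).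

Definition faces : set (set (R * R)) := components (~` drawn).

(* The curve may be constant on an interval, hence the last condition.        *)
Definition edge_segment (S : set (R * R)) :=
  exists e (a b : R), [/\ 0 <= a, a < b, b <= 1, S = curve D e @` `[a, b] &
    curve D e a <> curve D e b].

(* A segment is shared when it is in the boundary of both faces. To make      *)
(* sense of this when F1 = F2, where F1 has to lie on both sides of the       *)
(* segment, F1 and F2 are only looked at near the segment, in an open set U:  *)
(* there they have two different local pieces C1 and C2 that both reach the   *)
(* segment. If F1 <> F2, one can take for U the whole plane; see              *)
(* [face_adjacent_neq].                                                       *)
Definition face_adjacent (F1 F2 : set (R * R)) :=
  exists S U C1 C2, [/\ edge_segment S, open U, S `<=` U &
    [/\ components (U `\` drawn) C1, components (U `\` drawn) C2, C1 <> C2,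
        C1 `<=` F1 /\ C2 `<=` F2 & S `<=` closure C1 `&` closure C2]].

Lemma face_adjacent_neq (F1 F2 : set (R * R)) : faces F1 -> faces F2 -> F1 <> F2 ->
  face_adjacent F1 F2 <->
  exists2 S, edge_segment S & S `<=` closure F1 `&` closure F2.
Proof.
move=> F1f F2f F12; split.
  move=> [S [U [C1 [C2 [Ss _ _ [_ _ _ [C1F C2F] SC]]]]]].
  exists S => // x /SC [xC1 xC2].
  by split; [exact: closureS xC1|exact: closureS xC2].
move=> [S Ss SF]; exists S, setT, F1, F2.
split; [exact: Ss|exact: openT|exact: subsetT|rewrite setTD].
by split; [exact: F1f|exact: F2f|exact: F12|split|exact: SF].
Qed.

(* There is always a face, so asking for a value outside [faces] is harmless. *)
Definition face_colorable (k : nat) :=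
  exists c : set (R * R) -> 'I_k, forall F1 F2,
    faces F1 -> faces F2 -> face_adjacent F1 F2 -> c F1 <> c F2.
End Faces.

Definition facially_colorable (R : realType) (k : nat) (G : multigraph) :=
  forall D : drawing R G, face_colorable D k.

(* Main.v *)
Require Import Defs.
From mathcomp Require Import all_boot all_order all_algebra.
From mathcomp Require Import all_classical all_reals all_analysis.
From mathcomp Require Import ring lra zify.
Import Order.TTheory GRing.Theory Num.Theory.
Import numFieldNormedType.Exports.

Set Implicit Arguments.
Unset Strict Implicit.
Unset Printing Implicit Defensive.

Local Open Scope classical_set_scope.
Local Open Scope ring_scope.

(** Choose an argument of [v - x] for every vertex [v]. Up to these choices, an
edge [e] winds an integral number [n_e(x)] of times around a point [x] off the
drawing, and changing the choices adds a potential difference to [n_e], so the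
colour [sum_e f(e) n_e(x)] of [x] in Z_3 is well defined by conservation of the
flow. It is locally constant, hence constant on faces.

Near a point of [e] met by no other part of the drawing, only [n_e] matters,
and the colours of two points [x1], [x2] on either side differ by [f(e) m],
where [m] is the difference of the winding numbers of a small arc. It remains
to see that 3 does not divide [m] when [x1] and [x2] lie in different local
components. If the winding numbers were congruent modulo 3 at all points near
the arc, then an argument of [x - p], divided by 3, would be well defined
around a point [p] of the arc. So there is a third point [y] whose winding
number is not congruent to those of [x1] and [x2]. If 3 divides [m], a suitable
product of integral powers of [z - x1], [z - x2], [z - y] has a continuous
logarithm on the arc and far away, although one of [x1], [x2] is alone in its
component among these three points; Eilenberg's criterion excludes this. *)

(** * Circle-valued functions *)

Section CircleValued.
Variable R : realType.
Implicit Types x y : R.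

(** The circle is encoded as [R] modulo this relation, so a circle-valued function is a real
    function whose values count only up to multiples of 2 pi. *)
Definition congr2pi x y := exists k : int, x - y = k%:~R * (pi *+ 2).

Lemma congr2pi_refl x : congr2pi x x.
Proof. by exists 0; rewrite subrr mul0r. Qed.

Lemma congr2pi_sym x y : congr2pi x y -> congr2pi y x.
Proof. by move=> [k e]; exists (- k); rewrite rmorphN /= mulNr -e opprB. Qed.

Lemma congr2pi_trans y x (z : R) : congr2pi x y -> congr2pi y z -> congr2pi x z.
Proof.
move=> [k e] [l e']; exists (k + l); rewrite rmorphD /= mulrDl -e -e'.
by rewrite addrA subrK.
Qed.

Lemma congr2piD x y (z t : R) :
  congr2pi x y -> congr2pi z t -> congr2pi (x + z) (y + t).
Proof.
move=> [k e] [l e']; exists (k + l); rewrite rmorphD /= mulrDl -e -e'; ring.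
Qed.

Lemma congr2piN x y : congr2pi x y -> congr2pi (- x) (- y).
Proof. by move=> [k e]; exists (- k); rewrite rmorphN /= mulNr -e; ring. Qed.

Lemma congr2piB x y (z t : R) :
  congr2pi x y -> congr2pi z t -> congr2pi (x - z) (y - t).
Proof. by move=> ? /congr2piN; exact: congr2piD. Qed.

Lemma congr2piMz (k : int) x y :
  congr2pi x y -> congr2pi (k%:~R * x) (k%:~R * y).
Proof. by move=> [l e]; exists (k * l); rewrite rmorphM /= -mulrA -e mulrBr. Qed.

Lemma cos_int2pi (k : int) : cos (k%:~R * (pi *+ 2)) = 1 :> R.
Proof.
have nat2pi (n : nat) : cos (n%:R * (pi *+ 2)) = 1 :> R.
  elim: n => [|n IH]; first by rewrite mul0r cos0.
  by rewrite -natr1 mulrDl mul1r cosD2pi.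
by case: (intP k) => [|n|n]; rewrite ?rmorphN /= ?mulNr ?cosN; exact: nat2pi.
Qed.

Lemma sin_int2pi (k : int) : sin (k%:~R * (pi *+ 2)) = 0 :> R.
Proof. by apply: cos1sin0; rewrite cos_int2pi normr1. Qed.

Lemma congr2pi_cos x y : congr2pi x y -> cos x = cos y.
Proof.
move=> [k e]; have -> : x = y + k%:~R * (pi *+ 2) by rewrite -e; ring.
by rewrite cosD cos_int2pi sin_int2pi mulr1 mulr0 subr0.
Qed.

Lemma congr2pi_sin x y : congr2pi x y -> sin x = sin y.
Proof.
move=> [k e]; have -> : x = y + k%:~R * (pi *+ 2) by rewrite -e; ring.
by rewrite sinD cos_int2pi sin_int2pi mulr1 mulr0 addr0.
Qed.

Lemma pi2_gt0 : 0 < pi *+ 2 :> R.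
Proof. by rewrite pmulrn_rgt0 // pi_gt0. Qed.

Lemma cos_eq1 x : cos x = 1 -> congr2pi x 0.
Proof.
move=> cx; pose k := Num.floor (x / (pi *+ 2)).
pose y := x - k%:~R * (pi *+ 2).
have cy : cos y = 1.
  rewrite -cx; apply/congr2pi_cos; exists (- k); rewrite /y rmorphN /=; ring.
have p2 := pi2_gt0.
have y0 : 0 <= y by rewrite subr_ge0 -ler_pdivlMr // floor_le.
have yp : y < pi *+ 2.
  rewrite ltrBlDr -{1}[pi *+ 2]mul1r -mulrDl addrC -ltr_pdivrMr //.
  by rewrite -intrD1 floorD1_gt.
exists k; rewrite subr0; apply/eqP; rewrite -subr_eq0 -/y; apply/eqP.
(* Cosine is injective on [0, pi]; the other half of the period is brought there by the reflection y
   |-> 2 pi - y. *)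
have [ypi|piy] := leP y pi.
  apply: (@cos_inj R); rewrite ?in_itv /= ?y0 ?lexx ?pi_ge0 //.
  by rewrite cos0.
have : pi *+ 2 - y = 0; last by move=> e; move: yp; rewrite -subr_gt0 e ltxx.
apply: (@cos_inj R); rewrite ?in_itv /= ?lexx ?pi_ge0 //; first lra.
by rewrite cos0 cosB cos2pi sin2pi cy; ring.
Qed.

Lemma cos_sin_congr2pi x y : cos x = cos y -> sin x = sin y -> congr2pi x y.
Proof.
move=> cxy sxy; have /cos_eq1 [k e] : cos (x - y) = 1.
  by rewrite cosB cxy sxy -!expr2 cos2Dsin2.
by exists k; rewrite -e subr0.
Qed.

Lemma congr2pi_third_turn : ~ congr2pi (pi *+ 2 / 3) 0.
Proof.
move=> [k]; rewrite subr0 [LHS]mulrC => /(mulIf (lt0r_neq0 pi2_gt0)).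
move=> e; have : (1 : R) = (3 * k)%:~R by rewrite rmorphM /= -e; field.
by move=> /(@intr_inj R 1); lia.
Qed.

(** Otherwise the intermediate value theorem yields a value that differs from [c] by an odd multiple
    of pi. *)
Lemma congr2pi_const (f : R -> R) (a b c : R) : a <= b -> continuous f ->
  (forall t, a <= t <= b -> congr2pi (f t) c) -> f a = f b.
Proof.
move=> ab cf fc; apply: contrapT => fab.
have p0 := @pi_gt0 R.
have [k fa] := fc a ltac:(by rewrite lexx ab).
have [l fb] := fc b ltac:(by rewrite lexx ab).
have [v [m [vm vab]]] : exists v : R, exists m : int, v - c = (2 * m + 1)%:~R * pi /\
    Num.min (f a) (f b) <= v <= Num.max (f a) (f b).
  have kl : k != l by apply/eqP => kl; apply: fab; rewrite kl in fa; lra.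
  have main (k' l' : int) (u w : R) : (k' < l')%R -> u - c = k'%:~R * (pi *+ 2) ->
     w - c = l'%:~R * (pi *+ 2) -> u <= c + (2 * k' + 1)%:~R * pi <= w.
    move=> kl' eu ew; have : (k' + 1)%:~R <= (l'%:~R : R) by rewrite ler_int; lia.
    rewrite !rmorphD /= !rmorphM /=; nra.
  case: (ltgtP k l) kl => // [kl|lk] _.
  - exists (c + (2 * k + 1)%:~R * pi), k; split; first by rewrite addrC addKr.
    have := main _ _ _ _ kl fa fb => /andP[av vb].
    by rewrite ge_min le_max av vb orbT.
  - exists (c + (2 * l + 1)%:~R * pi), l; split; first by rewrite addrC addKr.
    have := main _ _ _ _ lk fb fa => /andP[bv va].
    by rewrite ge_min le_max bv va orbT.
have [|t] := @IVT R f a b v ab _ vab.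
  exact: continuous_subspaceT.
rewrite in_itv /= => /fc [n en] ft; move: en; rewrite ft vm => en.
have : ((2 * m + 1)%:~R = (2 * n)%:~R :> R).
  apply: (mulIf (lt0r_neq0 p0)); rewrite en rmorphM /=; ring.
by move=> /intr_inj; lia.
Qed.

(** When cos x > 0, this is the representative of [x] modulo 2 pi between - pi / 2 and pi / 2. It
    serves to add up small angle increments continuously. *)
Definition reduce x := asin (sin x).

Lemma reduce_congr x : 0 < cos x -> congr2pi (reduce x) x.
Proof.
move=> cx; have sx : -1 <= sin x <= 1 by rewrite sin_geN1 sin_le1.
apply: cos_sin_congr2pi; last by rewrite asinK // in_itv.
by rewrite cos_asin // -cos2sin2 sqrtr_sqr gtr0_norm.
Qed.

(** Continuity as a map to the unit circle, which tolerates jumps by multiples of 2 pi. *)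
Definition ccontinuous (T : topologicalType) (f : T -> R) (z : T) :=
  {for z, continuous (cos \o f)} /\ {for z, continuous (sin \o f)}.

Section Ccontinuous.
Variable T : topologicalType.
Implicit Types (f g : T -> R) (z : T).

Lemma continuous_ccontinuous f z : {for z, continuous f} -> ccontinuous f z.
Proof.
by move=> cf; split; apply: continuous_comp => //;
  [exact: continuous_cos|exact: continuous_sin].
Qed.

Lemma ccontinuousD f g z :
  ccontinuous f z -> ccontinuous g z -> ccontinuous (f \+ g) z.
Proof.
move=> [cf sf] [cg sg]; split.
  have -> : cos \o (f \+ g) =
      (cos \o f) \* (cos \o g) \- (sin \o f) \* (sin \o g).
    by apply/funext => t /=; rewrite cosD.
  by apply: cvgB; apply: cvgM.
have -> : sin \o (f \+ g) =
    (sin \o f) \* (cos \o g) \+ (cos \o f) \* (sin \o g).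
  by apply/funext => t /=; rewrite sinD.
by apply: cvgD; apply: cvgM.
Qed.

Lemma ccontinuousN f z : ccontinuous f z -> ccontinuous (\- f) z.
Proof.
move=> [cf sf]; split.
  by have -> : cos \o (\- f) = cos \o f by apply/funext => t /=; rewrite cosN.
have -> : sin \o (\- f) = \- (sin \o f) by apply/funext => t /=; rewrite sinN.
exact: cvgN.
Qed.

Lemma ccontinuousB f g z :
  ccontinuous f z -> ccontinuous g z -> ccontinuous (f \- g) z.
Proof. by move=> ? ?; apply: ccontinuousD => //; exact: ccontinuousN. Qed.

Lemma ccontinuousMz (k : int) f z :
  ccontinuous f z -> ccontinuous (fun t => k%:~R * f t) z.
Proof.
move=> cf; have natM (n : nat) : ccontinuous (fun t => n%:R * f t) z.
  elim: n => [|n IH].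
    apply: continuous_ccontinuous.
    have -> : (fun t => 0%:R * f t) = cst 0 by apply/funext => t; rewrite mul0r.
    exact: cvg_cst.
  have -> : (fun t => n.+1%:R * f t) = (fun t => n%:R * f t) \+ f.
    by apply/funext => t /=; rewrite -natr1 mulrDl mul1r.
  exact: ccontinuousD.
case: (intP k) => [|n|n]; [exact: (natM 0)|exact: (natM n.+1)|].
have -> : (fun t => (- n.+1%:Z)%:~R * f t) = \- (fun t => n.+1%:R * f t).
  by apply/funext => t /=; rewrite rmorphN mulNr.
exact: ccontinuousN.
Qed.

(** Gluing: near [z] the function [h] may switch freely between [f] and [g], because these agree on
    the circle at [z]. *)
Lemma ccontinuous_near f g h z : ccontinuous f z -> ccontinuous g z ->
  congr2pi (f z) (g z) ->
  (\forall w \near z, congr2pi (h w) (f w) \/ congr2pi (h w) (g w)) ->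
  ccontinuous h z.
Proof.
move=> [cf sf] [cg sg] fg hfg.
have hz : congr2pi (h z) (f z).
  case: (nbhs_singleton hfg) => // hg; apply: congr2pi_trans hg _.
  exact: congr2pi_sym.
have main (u : R -> R) : (forall x y, congr2pi x y -> u x = u y) ->
    {for z, continuous (u \o f)} -> {for z, continuous (u \o g)} ->
    {for z, continuous (u \o h)}.
  move=> uc uf ug; apply/cvgrPdist_lt => e e0 /=.
  move/cvgrPdist_lt : uf => /(_ _ e0) uf.
  move/cvgrPdist_lt : ug => /(_ _ e0) ug.
  apply: (filterS3 _ _ hfg uf ug) => w {}hfg ufw ugw /=; rewrite (uc _ _ hz).
  by case: hfg => /uc -> //; rewrite (uc _ _ fg).
by split; apply: main => // x y; [exact: congr2pi_cos|exact: congr2pi_sin].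
Qed.

Lemma ccontinuous_reduce f z : ccontinuous f z -> 0 < cos (f z) ->
  {for z, continuous (reduce \o f)}.
Proof.
move=> [_ sf] cfz.
have -> : reduce \o f = @asin R \o (sin \o f) by [].
apply: continuous_comp; first exact: sf.
apply: continuous_asin; rewrite /=.
have := cos2Dsin2 (f z); rewrite !expr2; nra.
Qed.

End Ccontinuous.

Lemma ccontinuous_comp (S T : topologicalType) (g : S -> T) (f : T -> R) z :
  {for z, continuous g} -> ccontinuous f (g z) -> ccontinuous (f \o g) z.
Proof.
by move=> cg [cf sf]; split;
  [apply: (@continuous_comp _ _ _ g (cos \o f))|
   apply: (@continuous_comp _ _ _ g (sin \o f))].
Qed.

End CircleValued.

(** * Arguments of plane vectors and lifts *)

Lemma continuous_pair (S T U : topologicalType) (f : S -> T) (g : S -> U) z :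
  {for z, continuous f} -> {for z, continuous g} ->
  {for z, continuous (fun w => (f w, g w))}.
Proof. by move=> cf cg; exact: (cvg_pair cf cg). Qed.

Lemma continuous_fst (T U : topologicalType) : continuous (@fst T U).
Proof. by move=> z; exact: cvg_fst. Qed.

Lemma continuous_snd (T U : topologicalType) : continuous (@snd T U).
Proof. by move=> z; exact: cvg_snd. Qed.

Section Argument.
Variable R : realType.
Implicit Types (a b d e r s t : R) (u v x y z : R * R).

Definition radius v := Num.sqrt (v.1 ^+ 2 + v.2 ^+ 2).

(** Principal argument, in ]-pi, pi]. Its jump across the negative axis is a full turn, hence
    invisible to [ccontinuous]. *)
Definition argument v :=
  if 0 <= v.2 then acos (v.1 / radius v) else - acos (v.1 / radius v).

Lemma neq0_coord v : v != 0 -> 0 < v.1 ^+ 2 + v.2 ^+ 2.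
Proof.
case: v => a b /= ab0; rewrite lt_def addr_ge0 ?sqr_ge0 // andbT.
by rewrite paddr_eq0 ?sqr_ge0 // !sqrf_eq0; move: ab0; rewrite xpair_eqE.
Qed.

Lemma radius_gt0 v : v != 0 -> 0 < radius v.
Proof. by move=> /neq0_coord; rewrite sqrtr_gt0. Qed.

Lemma cos_argument v : v != 0 -> cos (argument v) = v.1 / radius v.
Proof.
move=> v0; have r0 := radius_gt0 v0; have r2 := sqr_sqrtr (ltW (neq0_coord v0)).
have b : -1 <= v.1 / radius v <= 1.
  rewrite ler_pdivlMr // ler_pdivrMr // mulN1r mul1r -ler_norml.
  rewrite -(@ler_pXn2r _ 2) ?nnegrE ?(ltW r0) // real_normK ?num_real // r2.
  by rewrite lerDl sqr_ge0.
by rewrite /argument; case: ifP; rewrite ?cosN acosK // in_itv.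
Qed.

Lemma sin_argument v : v != 0 -> sin (argument v) = v.2 / radius v.
Proof.
move=> v0; have r0 := radius_gt0 v0; have r2 := sqr_sqrtr (ltW (neq0_coord v0)).
have b : -1 <= v.1 / radius v <= 1.
  by rewrite -cos_argument // cos_geN1 cos_le1.
have e : Num.sqrt (1 - (v.1 / radius v) ^+ 2) = `|v.2| / radius v.
  rewrite -[radius v in RHS]gtr0_norm // -normf_div -sqrtr_sqr; congr Num.sqrt.
  rewrite !expr_div_n r2.
  by rewrite -{1}(divff (lt0r_neq0 (neq0_coord v0))) -mulrBl addrAC subrr add0r.
rewrite /argument; case: ifP => [v20|/negbT]; rewrite ?sinN sin_acos // e.
  by rewrite ger0_norm.
by rewrite -ltNge => /ltr0_norm ->; rewrite mulNr opprK.
Qed.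

Lemma argument_polar r t : 0 < r -> congr2pi (argument (r * cos t, r * sin t)) t.
Proof.
move=> r0; set v : R * R := (_, _).
have rv : radius v = r.
  rewrite /radius /= !exprMn -mulrDr cos2Dsin2 mulr1 sqrtr_sqr gtr0_norm //.
have v0 : v != 0.
  apply: contraTneq r0 => v0; rewrite -rv v0 /radius /= expr0n /= addr0 sqrtr0.
  by rewrite ltxx.
by apply: cos_sin_congr2pi;
  rewrite ?cos_argument ?sin_argument // rv /= mulrAC divff ?gt_eqF // mul1r.
Qed.

Lemma radius_continuous : continuous radius.
Proof.
move=> v; apply: (@continuous_comp _ _ _ (fun v => v.1 ^+ 2 + v.2 ^+ 2)).
  by apply: cvgD; rewrite expr2; apply: cvgM; (exact: cvg_fst || exact: cvg_snd).
exact: sqrt_continuous.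
Qed.

Lemma ccontinuous_argument v : v != 0 -> ccontinuous argument v.
Proof.
move=> v0; have v0' : \forall w \near v, w != 0.
  exact: (@cvgr_neq0 R (R * R)%type _ (nbhs v) _ id v cvg_id v0).
have main (g : R * R -> R) (h : R -> R) : {for v, continuous g} ->
    (forall w, w != 0 -> h (argument w) = g w / radius w) ->
  {for v, continuous (h \o argument)}.
  move=> cg hg; rewrite /prop_for /continuous_at /= hg //.
  apply: (@cvg_trans _ ((g w / radius w) @[w --> v])).
    by apply: near_eq_cvg; apply: filterS v0' => w /= w0; rewrite hg.
  have r0 : radius v != 0 by rewrite gt_eqF // radius_gt0.
  exact: (cvgM cg (cvgV r0 (@radius_continuous v))).
by split;
  [apply: (main fst); [exact: cvg_fst|exact: cos_argument]|
   apply: (main snd); [exact: cvg_snd|exact: sin_argument]].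
Qed.

Lemma ccontinuous_argumentB (T : topologicalType) (f g : T -> R * R) (w : T) :
  {for w, continuous f} -> {for w, continuous g} -> f w != g w ->
  ccontinuous (fun w => argument (f w - g w)) w.
Proof.
move=> cf cg fg; apply: (@ccontinuous_comp _ _ _ (fun w => f w - g w)).
  exact: cvgB.
by apply: ccontinuous_argument; rewrite subr_eq0.
Qed.

Lemma cos_argumentB u v : u != 0 -> v != 0 ->
  0 < u.1 * v.1 + u.2 * v.2 -> 0 < cos (argument u - argument v).
Proof.
move=> u0 v0 uv; rewrite cosB !cos_argument // !sin_argument //.
have ru := radius_gt0 u0; have rv := radius_gt0 v0.
rewrite !mulf_div -mulrDl; apply: divr_gt0 => //; exact: mulr_gt0.
Qed.

(** Seen from [z], the points [x] and [y] are less than a quarter turn apart. Balls are squares: in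
    one coordinate the product in the inner product is at least e^2 / 2, and in the other it exceeds
    - e^2 / 16. *)
Lemma cos_argument_ball x y z e : 0 < e -> ~ ball x e z -> ball x (e / 2) y ->
  0 < cos (argument (z - y) - argument (z - x)).
Proof.
case: x y z => [x1 x2] [y1 y2] [z1 z2] e0 zx [/= yx1 yx2].
rewrite /ball /= in yx1 yx2.
have {}zx : e <= `|x1 - z1| \/ e <= `|x2 - z2|.
  have [|z1e] := leP e `|x1 - z1|; first by left.
  by have [|z2e] := leP e `|x2 - z2|; [right|case: zx].
have ge a b c : `|a - b| < e / 2 -> - (e ^+ 2 / 16) < (c - b) * (c - a).
  rewrite ltr_norml => /andP[? ?].
  have := sqr_ge0 (c - b + c - a); rewrite !expr2; nra.
have gt a b c : `|a - b| < e / 2 -> e <= `|a - c| ->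
    e ^+ 2 / 2 <= (c - b) * (c - a).
  by rewrite ltr_norml ler_normr !expr2 => /andP[? ?] /orP[?|?]; nra.
have e2 : 0 < e ^+ 2 by rewrite exprn_gt0.
have dot_gt0 : 0 < (z1 - y1) * (z1 - x1) + (z2 - y2) * (z2 - x2).
  have := ge _ _ z1 yx1; have := ge _ _ z2 yx2.
  by case: zx => [/(gt _ _ z1 yx1)|/(gt _ _ z2 yx2)]; lra.
by apply: cos_argumentB => //; apply: contraTneq dot_gt0 => -[/= -> ->];
  rewrite !(mulr0, mul0r) addr0 ltxx.
Qed.

(** Retraction of the line onto [a, b], used to extend functions given on the interval to continuous
    functions on the line. *)
Definition clamp a b t := Num.max a (Num.min b t).

Lemma clamp_id a b t : a <= t <= b -> clamp a b t = t.
Proof. by move=> /andP[at_ tb]; rewrite /clamp min_r // max_r. Qed.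

Lemma clamp_itv a b t : a <= b -> a <= clamp a b t <= b.
Proof. by move=> ab; rewrite /clamp le_max lexx ge_max ab ge_min lexx. Qed.

Lemma clamp_continuous a b : continuous (clamp a b).
Proof.
apply: max_fun_continuous; first by move=> ?; exact: cvg_cst.
apply: min_fun_continuous; first by move=> ?; exact: cvg_cst.
by move=> ?; exact: cvg_id.
Qed.

Definition box r : set (R * R) := [set z | `|z.1| <= r /\ `|z.2| <= r].

Lemma box_compact r : compact (box r).
Proof.
have -> : box r = `[- r, r]%classic `*` `[- r, r]%classic.
  by apply/seteqP; split => z /=; rewrite !in_itv /= -!ler_norml.
by apply: compact_setX; exact: segment_compact.
Qed.

Lemma ccontinuous_close (f : R * R -> R) z : ccontinuous f z ->
  exists2 e, 0 < e & forall u v, ball z e u -> ball z e v ->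
    0 < cos (f u - f v).
Proof.
move=> [/cvgrPdist_lt /(_ _ (ltac:(lra) : 0 < 1 / 4 :> R)) cf].
move=> /cvgrPdist_lt /(_ _ (ltac:(lra) : 0 < 1 / 4 :> R)) sf.
have [e e0 ze] := (nbhs_ballP _ _).1 (filterI cf sf); exists e => // u v.
have sqr_lt (x y c : R) : `|c - x| < 1 / 4 -> `|c - y| < 1 / 4 ->
    (x - y) ^+ 2 < 1 / 4.
  by rewrite !ltr_norml expr2 => /andP[? ?] /andP[? ?]; nra.
move=> /ze[/= cu su] /ze[/= cv sv].
(* The chord between the two points of the circle has squared length 2 - 2 cos (f u - f v), here
   less than 1/2. *)
have := sqr_lt _ _ _ cu cv; have := sqr_lt _ _ _ su sv.
have := cos2Dsin2 (f u); have := cos2Dsin2 (f v); rewrite cosB !expr2.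
set a := cos (f u); set b := sin (f u); set c := cos (f v); set d := sin (f v).
lra.
Qed.

(** Uniform continuity on a compact square: half of the radius given by [ccontinuous_close] works
    around each point, and compactness provides a common [d]. *)
Lemma ccontinuous_box_unif (f : R * R -> R) r :
  (forall z, box r z -> ccontinuous f z) ->
  exists2 d, 0 < d & forall u v, box r u -> ball u d v -> 0 < cos (f u - f v).
Proof.
move=> cf.
pose P (d : R) (u : R * R) := forall v, ball u d v -> 0 < cos (f u - f v).
have cov := (compact_near_coveringP _).1 (@box_compact r) _ _ P
  (at_right_proper_filter (0 : R)).
have : \forall d \near (0 : R)^'+, box r `<=` P d.
  apply: cov => z /cf /ccontinuous_close [e e0 ze].
  exists (ball z (e / 2), [set d | d < e / 2]) => /=.
    split; first by apply: nbhsx_ballx; rewrite divr_gt0.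
    by apply: nbhs_right_lt; rewrite divr_gt0.
  move=> [u d] [/= zu de] v uv; apply: ze.
    by apply: le_ball zu; rewrite ler_pdivrMr // ler_peMr ?ltW // ltr1n.
  rewrite (splitr e); apply: ball_triangle zu _; apply: le_ball uv.
  exact: ltW.
move=> near_d; have /filter_ex[d [d0 dP]] :=
  @filterI _ _ (at_right_proper_filter 0) _ _ near_d (nbhs_right_gt (0 : R)).
by exists d => // u v bu; exact: d0.
Qed.

(* The lift is transported along the homotopy [s |-> f (s *: z)], in steps   *)
(* short enough for consecutive values to differ by less than a quarter turn. *)
Lemma box_lift (f : R * R -> R) r : 0 <= r ->
  (forall z, box r z -> ccontinuous f z) ->
  exists2 g : R * R -> R, continuous g & forall z, box r z -> congr2pi (g z) (f z).
Proof.
move=> r0 cf; have [d d0 dP] := ccontinuous_box_unif cf.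
pose p (z : R * R) : R * R := (clamp (- r) r z.1, clamp (- r) r z.2).
have rr : - r <= r by rewrite -subr_ge0 opprK addr_ge0.
have boxp z : box r (p z) by split; rewrite ler_norml clamp_itv.
have p_id z : box r z -> p z = z.
  by case: z => a b [/=]; rewrite !ler_norml => ? ?; rewrite /p /= !clamp_id.
have cp : continuous p.
  move=> z; exact: (continuous_pair
    (continuous_comp (@continuous_fst _ _ z) (@clamp_continuous (- r) r z.1))
    (continuous_comp (@continuous_snd _ _ z) (@clamp_continuous (- r) r z.2))).
(* One step of the homotopy moves each coordinate by at most r / N, hence by less than [d]. *)
pose N := (Num.bound (r / d)).+1.
have N0 : 0 < N%:R :> R by rewrite ltr0n.
have rN : r / N%:R < d.
  rewrite ltr_pdivrMr // mulrC -ltr_pdivrMr //.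
  apply: lt_trans (_ : (Num.bound (r / d))%:R < _); last by rewrite ltr_nat.
  by have := @archi_boundP R (r / d) (divr_ge0 r0 (ltW d0)).
pose q (i : nat) z := (i%:R / N%:R) *: p z.
have qE i z : q i z = ((i%:R / N%:R) * (p z).1, (i%:R / N%:R) * (p z).2) by [].
have boxq i z : (i <= N)%N -> box r (q i z).
  move=> iN; have [b1 b2] := boxp z; rewrite qE; split => /=;
    rewrite normrM ger0_norm ?divr_ge0 // -[leRHS]mul1r; apply: ler_pM => //;
    by rewrite ?divr_ge0 // ler_pdivrMr // mul1r ler_nat.
have cq i : continuous (q i) by move=> z; apply: cvgZr; exact: cp.
have lift i : (i <= N)%N -> exists2 g : R * R -> R, continuous g &
    forall z, congr2pi (g z) (f (q i z)).
  elim: i => [_|i IH iN].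
    exists (cst (f 0)); first by move=> ?; exact: cvg_cst.
    by move=> z; rewrite /q mul0r scale0r; exact: congr2pi_refl.
  have [g cg gq] := IH (ltnW iN).
  have pos z : 0 < cos (f (q i.+1 z) - f (q i z)).
    rewrite -cosN opprB; apply: dP; first exact: boxq (ltnW iN).
    have dist (x : R) : `|x| <= r ->
        `|i%:R / N%:R * x - i.+1%:R / N%:R * x| < d.
      have -> : i%:R / N%:R * x - i.+1%:R / N%:R * x = - (x / N%:R).
        by rewrite -[i.+1%:R]natr1; field; rewrite gt_eqF.
      move=> xr; rewrite normrN normrM [X in _ * X]gtr0_norm ?invr_gt0 //.
      by apply: le_lt_trans rN; rewrite ler_wpM2r // invr_ge0 ltW.
    by have [? ?] := boxp z; rewrite !qE; split; exact: dist.
  exists (fun z => g z + reduce (f (q i.+1 z) - f (q i z))) => [z|z].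
    apply: cvgD; first exact: cg.
    apply: (@ccontinuous_reduce _ _ (fun z => f (q i.+1 z) - f (q i z))) => //.
    apply: ccontinuousB.
      exact: ccontinuous_comp (@cq i.+1 z) (cf _ (boxq _ _ iN)).
    exact: ccontinuous_comp (@cq i z) (cf _ (boxq _ _ (ltnW iN))).
  have := congr2piD (gq z) (reduce_congr (pos z)).
  by rewrite [X in congr2pi _ X]addrC subrK.
have [g cg gq] := lift N (leqnn N); exists g => // z bz.
have := gq z; rewrite /q divff ?gt_eqF // scale1r p_id //.
Qed.

(** Clamping extends [f] to a function on the plane that depends on the first coordinate only, and
    [box_lift] applies to it. *)
Lemma path_lift (f : R -> R) a b : a <= b ->
  (forall t, a <= t <= b -> ccontinuous f t) ->
  exists2 g : R -> R, continuous g & forall t, a <= t <= b -> congr2pi (g t) (f t).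
Proof.
move=> ab cf; pose r := Num.max `|a| `|b|.
have [|z bz|g cg gf] := @box_lift (fun z => f (clamp a b z.1)) r.
- by rewrite le_max normr_ge0.
- apply: (@ccontinuous_comp _ _ _ (clamp a b \o fst)); last exact/cf/clamp_itv.
  exact: continuous_comp (@continuous_fst _ _ z) (@clamp_continuous _ _ _).
exists (fun t => g (t, 0)) => [t|t tab].
  apply: (@continuous_comp _ _ _ (fun t => (t, 0)) g); last exact: cg.
  exact: (continuous_pair (@cvg_id _ _) (@cvg_cst _ _ _ _ _)).
have := gf (t, 0); rewrite /= clamp_id //; apply; split => /=.
  move: tab; rewrite /r le_max !ler_normr !ler_norml.
  by case: (ger0P a); case: (ger0P b); lra.
by rewrite normr0 le_max normr_ge0.
Qed.

End Argument.

(** * Turning of a path around a point *)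

Section Turn.
Variable R : realType.
Implicit Types (f g : R -> R) (a b c e t : R) (x y z : R * R).
Implicit Types (p : R -> R * R).

Definition lifts f a b g :=
  continuous g /\ forall t, a <= t <= b -> congr2pi (g t) (f t).

(** All lifts give the same difference, by [variationE]; [fun=> 0] is the default when there is no
    lift. *)
Definition variation f a b :=
  let g := xget (fun=> 0) (lifts f a b) in g b - g a.

Lemma variationE f a b g : a <= b -> lifts f a b g ->
  variation f a b = g b - g a.
Proof.
move=> ab gf; rewrite /variation; set h := xget _ _.
have [ch hf] : lifts f a b h by apply: xgetPex; exists g.
case: gf => cg gf.
have : (h - g) a = (h - g) b.
  apply: (@congr2pi_const _ (h - g) a b 0 ab) => [t|t tab].
    by apply: cvgB; [exact: ch|exact: cg].
  rewrite -(subrr (f t)); apply: congr2piB; [exact: hf|exact: gf].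
by rewrite !fctE => e; lra.
Qed.

Definition turn p a b x := variation (fun t => argument (p t - x)) a b.

(** Change of the direction towards [z] when the base point moves from [x] to [y], as a real number
    that is continuous as long as it stays below a quarter turn. *)
Definition angle z x y := reduce (argument (z - y) - argument (z - x)).

Lemma ball_neq z x y e : 0 < e -> ~ ball x e z -> ball x (e / 2) y -> y != z.
Proof.
move=> e0 zx yx; apply/eqP => yz; apply: zx; rewrite -yz.
by apply: le_ball yx; lra.
Qed.

Lemma ball_neq_center z x e : 0 < e -> ~ ball x e z -> z != x.
Proof. by move=> e0 zx; apply/eqP => zE; apply: zx; rewrite zE; exact: ballxx. Qed.

Lemma angle_congr z x y e : 0 < e -> ~ ball x e z -> ball x (e / 2) y ->
  congr2pi (angle z x y) (argument (z - y) - argument (z - x)).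
Proof. by move=> *; apply/reduce_congr/cos_argument_ball; eauto. Qed.

Lemma angle_continuous_l z x y e : 0 < e -> ~ ball x e z -> ball x (e / 2) y ->
  {for z, continuous (fun z => angle z x y)}.
Proof.
move=> e0 zx yx.
apply: (@ccontinuous_reduce _ _
  (fun z => argument (z - y) - argument (z - x))); last first.
  exact: cos_argument_ball e0 zx yx.
apply: ccontinuousB; apply: (@ccontinuous_argumentB _ _ id (cst _)) => //=;
  do ?[exact: cvg_id|exact: cvg_cst].
  by rewrite eq_sym (ball_neq e0 zx yx).
exact: ball_neq_center zx.
Qed.

Lemma angle_continuous_r z x y e : 0 < e -> ~ ball x e z -> ball x (e / 2) y ->
  {for y, continuous (angle z x)}.
Proof.
move=> e0 zx yx.
apply: (@ccontinuous_reduce _ _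
  (fun y => argument (z - y) - argument (z - x))); last first.
  exact: cos_argument_ball e0 zx yx.
apply: ccontinuousB; last by apply: continuous_ccontinuous; exact: cvg_cst.
apply: (@ccontinuous_argumentB _ _ (cst z) id) => /=;
  do ?[exact: cvg_id|exact: cvg_cst].
by rewrite eq_sym (ball_neq e0 zx yx).
Qed.

Lemma turn_lift p a b x : continuous p -> a <= b ->
  (forall t, a <= t <= b -> p t != x) ->
  exists2 g, lifts (fun t => argument (p t - x)) a b g &
    turn p a b x = g b - g a.
Proof.
move=> cp ab px; have [t tab|g cg gp] :=
    @path_lift _ (fun t => argument (p t - x)) a b ab.
  apply: (@ccontinuous_argumentB _ _ p (cst x)); last exact: px.
    exact: cp.
  exact: cvg_cst.
by exists g => //; exact: variationE.
Qed.

Lemma turn_congr p a b x : continuous p -> a <= b ->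
  (forall t, a <= t <= b -> p t != x) ->
  congr2pi (turn p a b x) (argument (p b - x) - argument (p a - x)).
Proof.
move=> cp ab px; have [g [_ gp] ->] := turn_lift cp ab px.
by apply: congr2piB; apply: gp; rewrite lexx ab.
Qed.

Lemma turn_cat p a c b x : continuous p -> a <= c -> c <= b ->
  (forall t, a <= t <= b -> p t != x) ->
  turn p a b x = turn p a c x + turn p c b x.
Proof.
move=> cp ac cb px; have ab := le_trans ac cb.
have [g [cg gp] ->] := turn_lift cp ab px.
rewrite /turn (@variationE _ _ _ g) //; last first.
  by split => // t /andP[? ?]; apply: gp; apply/andP; split; lra.
rewrite (@variationE _ _ _ g) //; last first.
  by split => // t /andP[? ?]; apply: gp; apply/andP; split; lra.
ring.
Qed.

(** Adding [angle (p t) x y] to a lift around [x] gives a lift around [y], so moving the base point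
    a little changes the turn only through the two ends of the path. *)
Lemma turn_angle p a b x y e : continuous p -> a <= b -> 0 < e ->
  (forall t, a <= t <= b -> ~ ball x e (p t)) -> ball x (e / 2) y ->
  turn p a b y = turn p a b x + angle (p b) x y - angle (p a) x y.
Proof.
move=> cp ab e0 px yx.
have [|g [cg gp] ->] := @turn_lift p a b x cp ab.
  by move=> t /px; exact: ball_neq_center.
(* A lift has to be continuous on the whole line, while [p] is known to avoid the ball on [a, b]
   only; hence the clamp. *)
pose h t := g t + angle (p (clamp a b t)) x y.
rewrite /turn (@variationE _ _ _ h) //.
  by rewrite /h !clamp_id ?lexx ?ab //; ring.
split=> [t|t tab].
  apply: cvgD; first exact: cg.
  have cpt : {for t, continuous (p \o clamp a b)}.
    exact: continuous_comp (@clamp_continuous _ a b t) (cp _).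
  exact: (continuous_comp cpt
    (angle_continuous_l e0 (px _ (clamp_itv t ab)) yx)).
rewrite /h clamp_id //.
have := congr2piD (gp t tab) (angle_congr e0 (px t tab) yx).
by rewrite [X in congr2pi _ X]addrC subrK.
Qed.

Lemma path_closed p a b : continuous p -> closed (p @` `[a, b]).
Proof.
move=> cp; apply: compact_closed; first exact: norm_hausdorff.
by apply: continuous_compact; [exact: continuous_subspaceT|exact: segment_compact].
Qed.

Lemma closed_ball_out (K : set (R * R)) x : closed K -> ~ K x ->
  exists2 e, 0 < e & forall y, ball x e y -> ~ K y.
Proof.
move=> cK Kx; have : nbhs x (~` K).
  by apply: open_nbhs_nbhs; split => //; exact: closed_openC.
by move/nbhs_ballP => [e e0 eK]; exists e => // y /eK.
Qed.

Lemma path_ball_out p a b x : continuous p ->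
  (forall t, a <= t <= b -> p t != x) ->
  exists2 e, 0 < e & forall t, a <= t <= b -> ~ ball x e (p t).
Proof.
move=> cp px; have [|e e0 eK] := closed_ball_out (@path_closed p a b cp) (x := x).
  by move=> [t /=]; rewrite in_itv /= => /px /eqP.
exists e => // t tab /eK; apply; exists t => //=; by rewrite in_itv.
Qed.

Lemma turn_continuous p a b x : continuous p -> a <= b ->
  (forall t, a <= t <= b -> p t != x) -> {for x, continuous (turn p a b)}.
Proof.
move=> cp ab px; have [e e0 pe] := path_ball_out cp px.
have xx : ball x (e / 2) x by apply: ballxx; lra.
have pa : ~ ball x e (p a) by apply: pe; rewrite lexx ab.
have pb : ~ ball x e (p b) by apply: pe; rewrite lexx ab.
have near_eq : \forall y \near x,
    turn p a b x + angle (p b) x y - angle (p a) x y = turn p a b y.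
  have : nbhs x (ball x (e / 2)) by apply: nbhsx_ballx; lra.
  by apply: filterS => y yx; rewrite -(turn_angle cp ab e0 pe yx).
rewrite /prop_for /continuous_at (turn_angle cp ab e0 pe xx).
apply: cvg_trans (near_eq_cvg near_eq) _.
apply: cvgB; last exact: angle_continuous_r pa xx.
by apply: cvgD; [exact: cvg_cst|exact: angle_continuous_r pb xx].
Qed.

End Turn.

(** * Crossing an arc *)

Section Circle.
Variable R : realType.

Definition circle (o : R * R) (r s : R) : R * R :=
  (o.1 + r * cos s, o.2 + r * sin s).

Lemma circle_continuous o r : continuous (circle o r).
Proof.
move=> s; apply: (@continuous_pair _ _ _ (fun s => o.1 + r * cos s)
  (fun s => o.2 + r * sin s)).
  apply: cvgD; first exact: cvg_cst.
  by apply: cvgM; [exact: cvg_cst|exact: continuous_cos].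
apply: cvgD; first exact: cvg_cst.
by apply: cvgM; [exact: cvg_cst|exact: continuous_sin].
Qed.

Lemma circle2pi o r : circle o r (pi *+ 2) = circle o r 0.
Proof. by rewrite /circle cos2pi sin2pi cos0 sin0. Qed.

Lemma argument_circle o r s : 0 < r -> congr2pi (argument (circle o r s - o)) s.
Proof.
move=> r0; have -> : circle o r s - o = (r * cos s, r * sin s).
  by rewrite /circle; case: o => a b /=; congr pair => /=; ring.
exact: argument_polar.
Qed.

Lemma argument_circleN o r s :
  0 < r -> congr2pi (argument (o - circle o r s)) (s + pi).
Proof.
move=> r0; have -> : o - circle o r s = (r * cos (s + pi), r * sin (s + pi)).
  by rewrite cosDpi sinDpi /circle; case: o => a b /=; congr pair => /=; ring.
exact: argument_polar.
Qed.

End Circle.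

Section CrossCut.
Variables (R : realType) (p : R -> R * R) (a c b e : R).
Hypotheses (p_cont : continuous p) (ac : a < c) (cb : c < b) (e_gt0 : 0 < e).
Hypothesis p_inj : forall s t, a <= s <= b -> a <= t <= b -> p s = p t -> s = t.
Hypothesis pa_out : ~ ball (p c) e (p a).
Hypothesis pb_out : ~ ball (p c) e (p b).
Implicit Types (s t : R) (x y z : R * R).

Definition beside x := ball (p c) (e / 2) x /\ forall t, a <= t <= b -> p t != x.

(** Turn of the arc around [x], with both ends corrected as if they were seen from [p c]. Its class
    modulo 2 pi is thus the same for all [x] beside the arc, and its jumps count the windings of the
    arc. *)
Definition crossing x :=
  turn p a b x - angle (p b) (p c) x + angle (p a) (p c) x.

Let ab : a <= b. Proof. exact: ltW (lt_trans ac cb). Qed.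

Lemma crossing_congr x : beside x ->
  congr2pi (crossing x) (argument (p b - p c) - argument (p a - p c)).
Proof.
move=> [xc px]; have := turn_congr p_cont ab px.
have A := angle_congr e_gt0 pa_out xc; have B := angle_congr e_gt0 pb_out xc.
move=> /congr2piB /(_ B) /congr2piD /(_ A); congr congr2pi; ring.
Qed.

(** Two branches of the argument of p c - x, obtained by transport along the arc from [p a] or from
    [p b]. Each is continuous in [x] off its own half of the arc. *)
Let arg_left x :=
  argument (p a - p c) + angle (p a) (p c) x + turn p a c x.
Let arg_right x :=
  argument (p b - p c) + angle (p b) (p c) x - turn p c b x.
Let left_free x := forall t, a <= t <= c -> p t != x.
Let right_free x := forall t, c <= t <= b -> p t != x.

Let arg_left_congr x : ball (p c) (e / 2) x -> left_free x ->
  congr2pi (arg_left x) (argument (p c - x)).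
Proof.
move=> xc px; have := turn_congr p_cont (ltW ac) px.
have := congr2piD (congr2pi_refl (argument (p a - p c)))
  (angle_congr e_gt0 pa_out xc).
by move=> /congr2piD H /H; congr congr2pi; ring.
Qed.

Let arg_right_congr x : ball (p c) (e / 2) x -> right_free x ->
  congr2pi (arg_right x) (argument (p c - x)).
Proof.
move=> xc px; have := turn_congr p_cont (ltW cb) px.
have := congr2piD (congr2pi_refl (argument (p b - p c)))
  (angle_congr e_gt0 pb_out xc).
by move=> /congr2piB H /H; congr congr2pi; ring.
Qed.

Let arg_left_continuous x : ball (p c) (e / 2) x -> left_free x ->
  {for x, continuous arg_left}.
Proof.
move=> xc px; apply: cvgD; last exact: turn_continuous (ltW ac) px.
apply: cvgD; first exact: cvg_cst.
exact: angle_continuous_r e_gt0 pa_out xc.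
Qed.

Let arg_right_continuous x : ball (p c) (e / 2) x -> right_free x ->
  {for x, continuous arg_right}.
Proof.
move=> xc px; apply: cvgB; last exact: turn_continuous (ltW cb) px.
apply: cvgD; first exact: cvg_cst.
exact: angle_continuous_r e_gt0 pb_out xc.
Qed.

Let arg_left_right x : beside x -> arg_left x - arg_right x =
  argument (p a - p c) - argument (p b - p c) + crossing x.
Proof.
move=> [xc px]; rewrite /arg_left /arg_right /crossing.
rewrite (turn_cat p_cont (ltW ac) (ltW cb) px); ring.
Qed.

Let open_free (u v : R) x : (forall t, u <= t <= v -> p t != x) ->
  \forall y \near x, forall t, u <= t <= v -> p t != y.
Proof.
move=> px; have [d d0 pd] := path_ball_out p_cont px.
have : nbhs x (ball x d) by exact: nbhsx_ballx.
apply: filterS => y xy t tuv; apply/eqP => pty; apply: (pd _ tuv).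
by rewrite pty.
Qed.

(* Were all crossing numbers congruent modulo [6 * pi], the thirds of         *)
(* [arg_left] and of [arg_right] would glue to a continuous cube root of the  *)
(* direction from [x] to [p c], for [x] on a circle around [p c].             *)
Lemma crossing_third x : beside x ->
  exists2 y, beside y & ~ congr2pi (crossing y / 3) (crossing x / 3).
Proof.
move=> xb; apply: contrapT => all3.
have {}all3 y : beside y -> congr2pi (crossing y / 3) (crossing x / 3).
  by move=> yb; apply: contrapT => y3; apply: all3; exists y.
(* The difference of the two branches at [x]; it is a multiple of 2 pi, so the right branch may be
   shifted by it. *)
pose k := argument (p a - p c) - argument (p b - p c) + crossing x.
have k0 : congr2pi k 0.
  rewrite /k -arg_left_right // -(subrr (argument (p c - x))).
  case: xb => xc px; apply: congr2piB.
    apply: arg_left_congr => // t /andP[at_ tc]; apply: px.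
    by rewrite at_ (le_trans tc (ltW cb)).
  apply: arg_right_congr => // t /andP[ct tb]; apply: px.
  by rewrite tb andbT (le_trans (ltW ac) ct).
pose w := circle (p c) (e / 4).
have w_cont : continuous w by exact: circle_continuous.
have e4 : 0 < e / 4 by rewrite divr_gt0.
have wc s : ball (p c) (e / 2) (w s).
  have small (u : R) : `|u| <= 1 -> forall v : R, `|v - (v + e / 4 * u)| < e / 2.
    rewrite ler_norml => /andP[? ?] v; rewrite ltr_norml; apply/andP; split; nra.
  by split; apply: small; [exact: cos_max|exact: sin_max].
have wNc s : w s != p c.
  apply/eqP => wE; have := @argument_circle R (p c) (e / 4) s e4.
  have := @argument_circleN R (p c) (e / 4) s e4.
  rewrite -/(w s) wE subrr => /congr2pi_sym H /(congr2pi_trans H).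
  have -> : s + pi = (s + pi) + 0 by rewrite addr0.
  move=> [m]; have -> : s + pi + 0 - s = pi by ring.
  move=> piE; have /(mulfI (lt0r_neq0 (pi_gt0 R))) :
      pi * 1%:~R = pi * (m * 2)%:~R :> R.
    by rewrite mulr1 [LHS]piE rmorphM /=; ring.
  by move=> /intr_inj; lia.
(* Since p c - w s has argument s + pi, subtracting [s] makes three times either function congruent
   to pi, while one tour of the circle lowers it by a third of a turn. *)
pose fl s := (arg_left (w s) - s) / 3.
pose fr s := (arg_right (w s) + k - s) / 3.
pose h s := if `[< left_free (w s) >] then fl s else fr s.
have fl_cont s : left_free (w s) -> ccontinuous fl s.
  move=> ls; apply: continuous_ccontinuous; apply: cvgM; last exact: cvg_cst.
  apply: cvgB; last exact: cvg_id.
  exact: continuous_comp (w_cont s) (arg_left_continuous (wc s) ls).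
have fr_cont s : right_free (w s) -> ccontinuous fr s.
  move=> rs; apply: continuous_ccontinuous; apply: cvgM; last exact: cvg_cst.
  apply: cvgB; last exact: cvg_id; apply: cvgD; last exact: cvg_cst.
  exact: continuous_comp (w_cont s) (arg_right_continuous (wc s) rs).
(* Here fl - fr is a third of the difference of the crossing numbers at [w s] and [x], so the
   assumption [all3] is exactly what gluing requires. *)
have flr s : left_free (w s) -> right_free (w s) -> congr2pi (fl s) (fr s).
  move=> ls rs; have sb : beside (w s).
    split => // t /andP[? ?]; have [tc|ct] := leP t c.
      by apply: ls; apply/andP.
    by apply: rs; apply/andP; split => //; exact: ltW.
  have [m mE] := all3 _ sb; exists m; rewrite -mE /fl /fr.
  have := arg_left_right sb; rewrite /k; lra.
(* By injectivity the two halves of the arc share only [p c], which is not on the circle. *)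
have left_or_right s : left_free (w s) \/ right_free (w s).
  have [?|/existsNP[t /not_implyP[tac /negP /negbNE /eqP pt]]] :=
    pselect (left_free (w s)); [by left|right => u ucb].
  apply/eqP => pu; have := p_inj _ _ (etrans pt (esym pu)).
  move: tac ucb => /andP[at_ tc] /andP[cu ub].
  rewrite at_ ub (le_trans tc (ltW cb)) (le_trans (ltW ac) cu).
  move=> /(_ isT isT) tu; have {}tc : t = c.
    by apply/le_anti; rewrite tc tu cu.
  by have := wNc s; rewrite -pt tc eqxx.
have h_cont s : ccontinuous h s.
  have [ls|ls] := pselect (left_free (w s)).
    apply: (ccontinuous_near (fl_cont _ ls) (fl_cont _ ls) (congr2pi_refl _)).
    have : \forall t \near s, left_free (w t) by exact: w_cont s _ (open_free ls).
    apply: filterS => t lt; left.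
    by rewrite /h; case: asboolP => // _; exact: congr2pi_refl.
  have [//|rs] := left_or_right s.
  apply: (ccontinuous_near (fr_cont _ rs) (fr_cont _ rs) (congr2pi_refl _)).
  have : \forall t \near s, right_free (w t) by exact: w_cont s _ (open_free rs).
  apply: filterS => t rt; left.
  by rewrite /h; case: asboolP => lt; [exact: flr|exact: congr2pi_refl].
have h3 s : congr2pi (3 * h s) pi.
  have third (u v : R) : 3 * ((u - v) / 3) = u - v by field.
  have -> : pi = s + pi - s :> R by ring.
  have ws := @argument_circleN R (p c) (e / 4) s e4.
  rewrite /h; case: asboolP => ls; rewrite /fl /fr third;
    apply: congr2piB; try exact: congr2pi_refl.
    by apply: congr2pi_trans ws; exact: arg_left_congr.
  have [//|rs] := left_or_right s.
  rewrite -[X in congr2pi _ X]addr0; apply: congr2piD => //.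
  by apply: congr2pi_trans ws; exact: arg_right_congr.
have p2 := @pi2_gt0 R.
have [g g_cont gh] := path_lift (ltW p2) (fun t _ => h_cont t).
have : 3 * g 0 = 3 * g (pi *+ 2).
  apply: (@congr2pi_const _ (fun t => 3 * g t) _ _ pi (ltW p2)) => [t|t tI].
    by apply: cvgM; [exact: cvg_cst|exact: g_cont].
  by apply: congr2pi_trans (h3 t); apply: (@congr2piMz _ 3); exact: gh.
move=> /(mulfI (_ : 3 != 0)) g02; have {}g02 : g 0 = g (pi *+ 2).
  by apply: g02; rewrite pnatr_eq0.
have h2pi : h (pi *+ 2) = h 0 - pi *+ 2 / 3.
  by rewrite /h /w circle2pi; case: ifP => _; rewrite /fl /fr /w circle2pi; field.
apply: (@congr2pi_third_turn R).
have G0 := gh 0 ltac:(by rewrite lexx ltW).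
have G2 := gh (pi *+ 2) ltac:(by rewrite lexx ltW).
have := congr2piB G0 G2; rewrite g02 subrr h2pi => /congr2pi_sym.
by congr congr2pi; ring.
Qed.

End CrossCut.

(** * Separation by an arc *)

Section Components.
Variable R : realType.
Implicit Types (A : set (R * R)) (x y z : R * R).

Lemma ball_connected z (e : R) : connected (ball z e).
Proof.
pose seg w := (fun t : R => z + t *: (w - z)) @` `[0, 1].
have -> : ball z e = \bigcup_(w in ball z e) seg w.
  apply/seteqP; split=> [w zw|_ [w [/= w1 w2] [t + <-]]].
    exists w => //; exists 1; rewrite /= ?in_itv /= ?ler01 ?lexx //.
    by rewrite scale1r addrC subrK.
  rewrite /= in_itv /= => /andP[t0 t1].
  have main (u v : R) : `|u - v| < e -> `|u - (u + t * (v - u))| < e.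
    move=> uv; apply: le_lt_trans uv; rewrite opprD addrA subrr add0r normrN.
    by rewrite normrM [leRHS]distrC (ger0_norm t0) ler_piMl.
  by split; exact: main.
apply: bigcup_connected.
  exists z => w _; exists 0; first by rewrite /= in_itv /= lexx ler01.
  by rewrite scale0r addr0.
move=> w _; apply: connected_continuous_connected; first exact: segment_connected.
apply: continuous_subspaceT => t; apply: cvgD; first exact: cvg_cst.
by apply: cvgZl; exact: cvg_id.
Qed.

Lemma component_nbhs A x : open A -> A x -> nbhs x (connected_component A x).
Proof.
move=> oA Ax; have /nbhs_ballP[e e0 eA] : nbhs x A by exact: open_nbhs_nbhs.
apply/nbhs_ballP; exists e => //; apply: connected_component_max => //.
  exact: ballxx.
exact: ball_connected.
Qed.

Lemma component_open A x : open A -> open (connected_component A x).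
Proof.
move=> oA; rewrite openE => y xy; rewrite /interior.
rewrite (same_connected_component xy); apply: component_nbhs => //.
exact: connected_component_sub xy.
Qed.

End Components.

(** * Eilenberg's criterion for an arc *)

Section Separation.
Variables (R : realType) (p : R -> R * R) (a c b e r : R) (P : set (R * R)).
Hypotheses (p_cont : continuous p) (ac : a < c) (cb : c < b) (e_gt0 : 0 < e).
Hypothesis p_inj : forall s t, a <= s <= b -> a <= t <= b -> p s = p t -> s = t.
Hypotheses (P_closed : closed P) (r_gt0 : 0 < r).
Hypothesis P_far : forall z, P z -> ~ ball (p c) e z.
Hypothesis P_cobounded : forall z, ~ ball (p c) r z -> P z.
Hypotheses (Pa : P (p a)) (Pb : P (p b)).
Hypothesis P_ends : forall t, a <= t <= b -> P (p t) -> t = a \/ t = b.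
Implicit Types (s t : R) (x y z : R * R).

Let K := P `|` p @` `[a, b].

Let ab : a <= b. Proof. exact: ltW (lt_trans ac cb). Qed.

Let K_closed : closed K.
Proof. by apply: closedU => //; exact: path_closed. Qed.

Let beside_out x : beside p a c b e x -> ~ K x.
Proof.
move=> [xc px] [/P_far|[t /=]]; last by rewrite in_itv /= => /px /eqP.
by apply; apply: le_ball xc; move: e_gt0; lra.
Qed.

Section Weights.
Variables (q1 q2 q3 : R * R) (a1 a2 a3 : int).
Hypotheses (q1b : beside p a c b e q1) (q2b : beside p a c b e q2).
Hypothesis q3b : beside p a c b e q3.
Hypothesis sum0 : a1 + a2 + a3 = 0.
Hypothesis crossing0 : a1%:~R * crossing p a c b q1 +
  a2%:~R * crossing p a c b q2 + a3%:~R * crossing p a c b q3 = 0.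

(** Applied to [fun x => argument (z - x)], this is an argument of the product of the powers (z -
    q_i)^a_i. As the weights add up to zero, terms independent of the point cancel. *)
Let S (F : R * R -> R) := a1%:~R * F q1 + a2%:~R * F q2 + a3%:~R * F q3.

Let S_congr (F G : R * R -> R) :
  (forall x, beside p a c b e x -> congr2pi (F x) (G x)) -> congr2pi (S F) (S G).
Proof.
move=> FG; apply: congr2piD; last exact/congr2piMz/FG.
by apply: congr2piD; exact/congr2piMz/FG.
Qed.

Let S_cst (F : R * R -> R) k : S (fun x => F x - k) = S F.
Proof.
rewrite /S; have : a1%:~R + a2%:~R + a3%:~R = 0 :> R.
  by rewrite -!rmorphD /= sum0.
by move=> s0; rewrite -[RHS]subr0 -(mul0r k) -s0; ring.
Qed.

Let S_continuous (T : topologicalType) (F : R * R -> T -> R) (z : T) :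
  (forall x, beside p a c b e x -> {for z, continuous (F x)}) ->
  {for z, continuous (fun w => S (F ^~ w))}.
Proof.
move=> cF; apply: cvgD; first apply: cvgD.
all: by apply: cvgM; [exact: cvg_cst|exact: cF].
Qed.

Let g x := xget (fun=> 0) (lifts (fun t => argument (p t - x)) a b).

Let g_lifts x : beside p a c b e x ->
  lifts (fun t => argument (p t - x)) a b (g x).
Proof.
move=> [_ px]; have [h hl _] := turn_lift p_cont ab px.
by apply: xgetPex; exists h.
Qed.

(** Real branches of the argument of that product, [arc_log] along the arc and [out_log] on [P],
    normalised to agree at [p a]. *)
Let arc_log t := S (fun x => angle (p a) (p c) x + (g x t - g x a)).

Let out_log z := S (angle z (p c)).

Let arc_log_continuous : continuous arc_log.
Proof.
move=> t.
apply: (@S_continuous _ (fun x t => angle (p a) (p c) x + (g x t - g x a))).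
move=> x /g_lifts [cg _]; apply: cvgD; first exact: cvg_cst.
by apply: cvgB; [exact: cg|exact: cvg_cst].
Qed.

Let out_log_continuous z : P z -> {for z, continuous out_log}.
Proof.
move=> Pz; apply: (@S_continuous _ (fun x z => angle z (p c) x)) => x [xc _].
exact: angle_continuous_l e_gt0 (P_far Pz) xc.
Qed.

Let arc_log_congr t : a <= t <= b ->
  congr2pi (arc_log t) (S (fun x => argument (p t - x))).
Proof.
move=> tab; rewrite -(S_cst _ (argument (p a - p c))); apply: S_congr => x xb.
have [_ gx] := g_lifts xb; have aab : a <= a <= b by rewrite lexx ab.
have := congr2piD (angle_congr e_gt0 (P_far Pa) xb.1)
  (congr2piB (gx t tab) (gx a aab)).
by congr congr2pi; ring.
Qed.

Let out_log_congr z : P z -> congr2pi (out_log z) (S (fun x => argument (z - x))).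
Proof.
move=> Pz; rewrite -(S_cst _ (argument (z - p c))); apply: S_congr => x xb.
exact: angle_congr e_gt0 (P_far Pz) xb.1.
Qed.

Let log_a : arc_log a = out_log (p a).
Proof. by rewrite /arc_log /out_log /S !subrr !addr0. Qed.

(** At the far end the two branches differ by the weighted sum of the crossing numbers, which is
    zero by [crossing0]. *)
Let log_b : arc_log b = out_log (p b).
Proof.
have E x : angle (p a) (p c) x + (g x b - g x a) =
  crossing p a c b x + angle (p b) (p c) x.
  by rewrite /crossing -[turn _ _ _ _]/(g x b - g x a); ring.
rewrite /arc_log /out_log /S !E -[RHS]add0r -crossing0; ring.
Qed.

Let log z := if `[< P z >] then out_log z
  else arc_log (xget a [set t | a <= t <= b /\ p t = z]).

Let log_out z : P z -> log z = out_log z.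
Proof. by rewrite /log; case: asboolP. Qed.

Let log_arc t : a <= t <= b -> log (p t) = arc_log t.
Proof.
move=> tab; rewrite /log; case: asboolP => [Pt|_].
  by have [->|->] := P_ends tab Pt; rewrite ?log_a ?log_b.
congr arc_log; set u := xget _ _.
have [uab pu] : a <= u <= b /\ p u = p t.
  by apply: (@xgetPex _ a [set t' | a <= t' <= b /\ p t' = p t]); exists t.
exact: p_inj.
Qed.

Let log_congr z : K z -> congr2pi (log z) (S (fun x => argument (z - x))).
Proof.
move=> [Pz|[t /=]]; first by rewrite log_out //; exact: out_log_congr.
by rewrite in_itv /= => tab <-; rewrite log_arc //; exact: arc_log_congr.
Qed.

Let log_continuous : {within K, continuous log}.
Proof.
apply: withinU_continuous => //; first exact: path_closed.
  apply: (@subspace_eq_continuous _ P _ out_log).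
    by move=> z /set_mem Pz; exact: esym (log_out Pz).
  apply: continuous_in_subspaceT => z /set_mem Pz; exact: out_log_continuous.
(* On the arc, the preimage of a closed set is the image under [p] of a compact set of
   parameters. *)
apply/continuous_closedP => A cA; apply/closed_subspaceP.
exists (p @` (`[a, b] `&` arc_log @^-1` A)).
  apply: compact_closed; first exact: norm_hausdorff.
  apply: continuous_compact; first exact: continuous_subspaceT.
  apply: compact_closedI; first exact: segment_compact.
  by move/continuous_closedP : arc_log_continuous; exact.
apply/seteqP; split=> z.
  move=> [[t [/= + At] <-] ptK]; rewrite in_itv /= => tab; split => //=.
  by change (A (log (p t))); rewrite log_arc.
move=> [/= Az [t /= tab tz]]; split; last by exists t.
exists t => //; split => //=; rewrite -log_arc ?tz //.
Qed.

(** Prepares the Tietze extension, which is stated for bounded functions: angles are at most pi / 2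
    in absolute value, and [arc_log] is continuous on a compact interval. *)
Let log_bounded : exists2 M : R, 0 < M & forall z, K z -> `|log z| <= M.
Proof.
have c_norm : {within `[a, b], continuous (Num.norm \o arc_log)}.
  apply: continuous_subspaceT => t.
  by apply: continuous_comp; [exact: arc_log_continuous|exact: norm_continuous].
have [u _ uM] := EVT_max ab c_norm.
pose M1 := (`|a1%:~R| + `|a2%:~R| + `|a3%:~R|) * (pi / 2) : R.
have angle_le z x y : `|angle z x y| <= pi / 2.
  by rewrite ler_norml /angle /reduce asin_geNpi2 ?asin_lepi2 // sin_geN1 sin_le1.
have M1P z : `|out_log z| <= M1.
  rewrite /out_log /S /M1 [leRHS]mulrDl [X in _ <= X + _]mulrDl.
  apply: le_trans (ler_normD _ _) _; apply: lerD.
    apply: le_trans (ler_normD _ _) _; apply: lerD.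
      by rewrite normrM; apply: ler_wpM2l => //; exact: angle_le.
    by rewrite normrM; apply: ler_wpM2l => //; exact: angle_le.
  by rewrite normrM; apply: ler_wpM2l => //; exact: angle_le.
have M10 : 0 <= M1 by exact: le_trans (M1P (0, 0)).
exists (M1 + `|arc_log u| + 1).
  by rewrite ltr_wpDl // addr_ge0.
move=> z [Pz|[t /= tab <-]].
  by rewrite log_out //; have := M1P z; have := normr_ge0 (arc_log u); lra.
rewrite log_arc; last by move: tab; rewrite in_itv.
by have := uM _ tab; rewrite /=; lra.
Qed.

(* The product of the [(z - q_i) ^ a_i] has a continuous logarithm [L] on [K]. *)
(* Extend [L] to the plane, and replace [(z - q1) ^ a1] in the component of   *)
(* [q1] by [exp L / ((z - q2) ^ a2 * (z - q3) ^ a3)]. The result is nowhere   *)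
(* zero on the plane and equals [(z - q1) ^ a1] far away, hence [a1 = 0].     *)
Lemma weight_eq0 : ~ connected_component (~` K) q1 q2 ->
  ~ connected_component (~` K) q1 q3 -> a1 = 0.
Proof.
set W := connected_component _ _ => q2W q3W.
have oK : open (~` K) by exact: closed_openC.
have W_open : open W by exact: component_open.
have q1W : W q1 by apply: connected_component_refl; exact: beside_out.
have [M M0 logM] := log_bounded.
have [L [Llog cL _]] := @continuous_bounded_extension (R * R)%type R
  pseudometric_normal K K_closed log M M0 log_continuous logM.
have {}Llog z : K z -> L z = log z by move=> /mem_set /Llog.
(* The arguments to be glued: [f] is singular at [q2] and [q3], outside [W], and [h] at [q1], inside
   [W]. *)
pose f z := L z - a2%:~R * argument (z - q2) - a3%:~R * argument (z - q3).
pose h z := a1%:~R * argument (z - q1).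
pose G z := if `[< W z >] then f z else h z.
have arg_cont q z : z != q -> ccontinuous (fun z => argument (z - q)) z.
  move=> zq; apply: (@ccontinuous_argumentB _ _ id (cst q)) => //.
  exact: cvg_cst.
have f_cont z : z != q2 -> z != q3 -> ccontinuous f z.
  move=> z2 z3; apply: ccontinuousB; last exact/ccontinuousMz/arg_cont.
  apply: ccontinuousB; last exact/ccontinuousMz/arg_cont.
  by apply: continuous_ccontinuous; exact: cL.
have h_cont z : z != q1 -> ccontinuous h z.
  by move=> z1; exact/ccontinuousMz/arg_cont.
have fh z : K z -> congr2pi (f z) (h z).
  move=> Kz; have := log_congr Kz; rewrite -Llog // /f /h /S => H.
  have := congr2piB H (congr2pi_refl
    (a2%:~R * argument (z - q2) + a3%:~R * argument (z - q3))).
  by congr congr2pi; ring.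
have G_cont z : ccontinuous G z.
  have [Wz|Wz] := pselect (W z).
    have fz : ccontinuous f z.
      by apply: f_cont; [apply: contra_notN q2W|apply: contra_notN q3W] => /eqP <-.
    apply: (ccontinuous_near fz fz (congr2pi_refl _)).
    have : nbhs z W by exact: open_nbhs_nbhs.
    by apply: filterS => w Ww; left; rewrite /G asboolT //; exact: congr2pi_refl.
  have z1 : z != q1 by apply: contra_notN Wz => /eqP ->.
  (* On [K] both branches agree modulo 2 pi; every remaining point has a neighbourhood in another
     component, disjoint from [W]. *)
  have [Kz|Kz] := pselect (K z).
    have out q : beside p a c b e q -> z != q.
      by move=> /beside_out; apply: contra_notN => /eqP <-.
    apply: (ccontinuous_near (f_cont z (out _ q2b) (out _ q3b)) (h_cont z z1)
      (fh z Kz)).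
    have : nbhs z setT by exact: filterT.
    by apply: filterS => w _; rewrite /G; case: asboolP => _;
      [left|right]; exact: congr2pi_refl.
  apply: (ccontinuous_near (h_cont z z1) (h_cont z z1) (congr2pi_refl _)).
  have : nbhs z (connected_component (~` K) z) by exact: component_nbhs.
  apply: filterS => w zw; left; rewrite /G asboolF; first exact: congr2pi_refl.
  move=> Ww; apply: Wz; apply: connected_component_trans Ww _.
  exact: connected_component_sym.
(* If [w s] were in the ball of radius [r], both its coordinates would be within r + e / 2 = rho / 2
   of those of [q1], too close for a point at distance [rho]. *)
pose rho := 2 * r + e.
have rho0 : 0 < rho by rewrite /rho; move: r_gt0 e_gt0; lra.
pose w := circle q1 rho.
have wP s : P (w s).
  apply: P_cobounded => -[/= w1 w2]; have [[/= d1 d2] _] := q1b.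
  have far (u v k : R) : `|u - v| < e / 2 -> `|u - (v + k)| < r ->
      k ^+ 2 < (rho / 2) ^+ 2.
    rewrite !ltr_norml /rho !expr2 => /andP[? ?] /andP[? ?]; nra.
  have := far _ _ _ d1 w1; have := far _ _ _ d2 w2; have := cos2Dsin2 s.
  have : 0 < rho ^+ 2 by rewrite exprn_gt0.
  rewrite !exprMn !expr2; nra.
pose B := `|q1.1| + `|q1.2| + rho.
have wB s : box B (w s).
  have small (u v : R) : `|u| <= 1 -> `|v + rho * u| <= `|v| + rho.
    move=> u1; apply: le_trans (ler_normD _ _) _; rewrite lerD2l normrM gtr0_norm //.
    by rewrite ler_piMr // ltW.
  have := small _ q1.1 (cos_max s); have := small _ q1.2 (sin_max s).
  by rewrite /box /B /=; have := normr_ge0 q1.1; have := normr_ge0 q1.2; split; lra.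
have B0 : 0 <= B.
  rewrite /B; have := normr_ge0 q1.1; have := normr_ge0 q1.2; move: rho0; lra.
have [T cT TG] := box_lift B0 (fun z _ => G_cont z).
have p2 := @pi2_gt0 R.
(* On the circle [T] is congruent to a1 * s. One tour adds [a1] turns to the latter and nothing to
   [T]. *)
have : T (w 0) - a1%:~R * 0 = T (w (pi *+ 2)) - a1%:~R * (pi *+ 2).
  apply: (@congr2pi_const _ (fun s => T (w s) - a1%:~R * s) _ _ 0 (ltW p2))
    => [s|s _].
    apply: cvgB.
      exact: continuous_comp (@circle_continuous R q1 rho s) (cT _).
    by apply: cvgM; [exact: cvg_cst|exact: cvg_id].
  rewrite -(subrr (a1%:~R * s)); apply: congr2piB; last exact: congr2pi_refl.
  apply: congr2pi_trans (TG _ (wB s)) _; rewrite /G asboolF.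
    by apply: congr2piMz; exact: argument_circle.
  by move=> /connected_component_sub; apply; left.
rewrite /w circle2pi mulr0 subr0 => /eqP; rewrite -subr_eq0 opprB addrC subrK.
by rewrite mulf_eq0 (gt_eqF p2) orbF intr_eq0 => /eqP.
Qed.

End Weights.

(** Let [m1] and [m2] be the crossing numbers of [x1] and [x2] relative to [y], in turns; both are
    nonzero by the choice of [y]. The weights m2, - m1, m1 - m2 on x1, x2, y, or their opposites,
    balance the crossing numbers. If [y] is in the component of [x1], then [x2] is alone among the
    three points, otherwise [x1] is, and its weight would vanish. *)
Lemma crossing_separated x1 x2 : beside p a c b e x1 -> beside p a c b e x2 ->
  ~ connected_component (~` K) x1 x2 ->
  ~ congr2pi (crossing p a c b x1 / 3) (crossing p a c b x2 / 3).
Proof.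
move=> x1b x2b x12 c12.
have [y yb y1] := crossing_third p_cont ac cb e_gt0 p_inj (P_far Pa) (P_far Pb) x1b.
have turns x : beside p a c b e x ->
    congr2pi (crossing p a c b x) (crossing p a c b y).
  have cc := crossing_congr p_cont ac cb e_gt0 (P_far Pa) (P_far Pb).
  by move=> /cc xc; apply: congr2pi_trans xc _; exact/congr2pi_sym/cc.
have [m1 e1] := turns _ x1b; have [m2 e2] := turns _ x2b.
have m1n0 : m1 <> 0.
  move=> m0; apply: y1; have -> : crossing p a c b y = crossing p a c b x1.
    by move: e1; rewrite m0 mul0r => /eqP; rewrite subr_eq0 => /eqP.
  exact: congr2pi_refl.
have m2n0 : m2 <> 0.
  move=> m0; apply: y1; have -> : crossing p a c b y = crossing p a c b x2.
    by move: e2; rewrite m0 mul0r => /eqP; rewrite subr_eq0 => /eqP.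
  exact: congr2pi_sym.
have E1 : crossing p a c b x1 = crossing p a c b y + m1%:~R * (pi *+ 2).
  by rewrite -e1; ring.
have E2 : crossing p a c b x2 = crossing p a c b y + m2%:~R * (pi *+ 2).
  by rewrite -e2; ring.
have [y1W|y1W] := pselect (connected_component (~` K) x1 y).
  apply: m1n0; apply: (@weight_eq0 x2 x1 y m1 (- m2) (m2 - m1)) => //.
  - by ring.
  - by rewrite E1 E2 !rmorphD !rmorphN /=; ring.
  - by move=> /connected_component_sym.
  - move=> /connected_component_sym yx2; apply: x12.
    exact: connected_component_trans yx2.
apply: m2n0; apply: (@weight_eq0 x1 x2 y m2 (- m1) (m1 - m2)) => //.
- by ring.
- by rewrite E1 E2 !rmorphD !rmorphN /=; ring.
Qed.

End Separation.

(** * The colouring *)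

Section SignedFlow.
Variables (G : multigraph) (k : nat) (o : orientation G) (f : edge G -> 'Z_k).

(** The flow rewritten for the orientation of every edge from [end0] to [end1], the direction in
    which curves are drawn. *)
Definition signed_flow e := if o e then - f e else f e.

Lemma signed_flow_conserved v : nowhere_zero_flow o f ->
  \sum_(e | end1 e == v) signed_flow e = \sum_(e | end0 e == v) signed_flow e.
Proof.
move=> [_ /(_ v) /eqP]; rewrite -subr_eq0 => /eqP fv.
apply/eqP; rewrite -subr_eq0 -[X in _ == X]fv; apply/eqP.
rewrite ![\sum_(e | _ == v) _]big_mkcond -!sumrB; apply: eq_bigr => e _.
rewrite /signed_flow /arc_head /arc_tail.
by case: (o e); do 2![case: ifP => _]; rewrite ?subrr ?subr0 ?sub0r ?opprK.
Qed.

(** Summation by parts: each [j v] is multiplied by the net flow into [v], which is zero. *)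
Lemma sum_potential (j : vertex G -> int) : nowhere_zero_flow o f ->
  \sum_e signed_flow e *~ (j (end1 e) - j (end0 e)) = 0.
Proof.
move=> fl; under eq_bigr do rewrite mulrzBr; rewrite sumrB.
rewrite (partition_big (@end1 G) xpredT) //.
rewrite [X in _ - X](partition_big (@end0 G) xpredT) //=.
rewrite -sumrB big1 // => v _.
under eq_bigr => e /eqP -> do [].
under [X in _ - X]eq_bigr => e /eqP -> do [].
by rewrite -!mulrz_suml signed_flow_conserved // subrr.
Qed.

Lemma signed_flow_neq0 e : nowhere_zero_flow o f -> signed_flow e != 0.
Proof. by move=> [f0 _]; rewrite /signed_flow; case: ifP; rewrite ?oppr_eq0. Qed.

End SignedFlow.

Lemma Z3_mulrz_eq0 (x : 'Z_3) (n : int) : x != 0 -> x *~ n = 0 -> (3 %| n)%Z.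
Proof.
rewrite (divz_eq n 3) mulrzDr mulrC mulrzA.
have -> : x *~ 3 = 0 by apply/val_inj; case: x => [[|[|[|]]]].
rewrite mul0rz add0r; have := modz_ge0 n (isT : 3 != 0 :> int).
have := ltz_mod n (isT : 3 != 0 :> int).
move: (n %% 3)%Z => [[|[|[|]]]|] //= _ _ x0.
- by rewrite addr0 dvdz_mulr.
- by move=> /eqP; rewrite (negPf x0).
- move=> e; case/negP: x0; apply/eqP/val_inj; move/(congr1 val): e.
  by case: x => [[|[|[|]]]].
Qed.

(** Finite sets are closed, so a point of [A] is both open and closed in [A]. *)
Lemma connected_finite (T : topologicalType) (A B : set T) (x y : T) :
  accessible_space T -> connected A -> finite_set B -> A `<=` B ->
  A x -> A y -> x = y.
Proof.
move=> aT cA fB AB Ax Ay.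
have AE : A `&` [set x] = A; last first.
  by have [] : (A `&` [set x]) y by rewrite AE.
apply: cA; first by exists x.
  exists (~` (B `\ x)).
    apply: closed_openC; apply: (accessible_finite_set_closed.1 aT).
    exact: finite_setD.
  apply/seteqP; split=> z [Az]; first by move=> ->; split => // -[_]; exact.
  move=> nBz; split => //; apply: contrapT => zx; apply: nBz; split => //.
  exact: AB.
by exists [set x] => //; exact: accessible_closed_set1.
Qed.

(** * Winding numbers and the colour of a point *)

Section Colouring.
Variables (R : realType) (G : multigraph) (D : drawing R G).
Implicit Types (e : edge G) (s t : R) (x y z : R * R).

(** Clamping makes the curve continuous on the whole line, as the lemmas on turns require. *)
Definition edge_path e t := curve D e (clamp 0 1 t).

Lemma edge_pathE e t : 0 <= t <= 1 -> edge_path e t = curve D e t.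
Proof. by move=> t01; rewrite /edge_path clamp_id. Qed.

Lemma edge_path_continuous e : continuous (edge_path e).
Proof.
move=> t; have ct := @clamp_itv R 0 1 t ler01.
have /subspace_continuousP /(_ (clamp 0 1 t)) := @curve_continuous R G D e.
rewrite /= in_itv /= => /(_ ct) cc.
apply: cvg_trans cc => A; rewrite /= /within /= => wA.
have near_t : \forall s \near t, clamp 0 1 s \in `[0, 1] ->
  A (curve D e (clamp 0 1 s)) by exact: (@clamp_continuous R 0 1 t _ wA).
suff : \forall s \near t, A (edge_path e s) by [].
by apply: filterS near_t => s /=; apply; rewrite in_itv /= clamp_itv ?ler01.
Qed.

Lemma edge_path0 e : edge_path e 0 = pos D (end0 e).
Proof. by rewrite edge_pathE ?lexx ?ler01 // curve0. Qed.

Lemma edge_path1 e : edge_path e 1 = pos D (end1 e).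
Proof. by rewrite edge_pathE ?lexx ?ler01 // curve1. Qed.

Lemma drawn_path e t : drawn D (edge_path e t).
Proof.
right; exists e => //; exists (clamp 0 1 t) => //=.
by rewrite in_itv /= clamp_itv // ler01.
Qed.

Lemma drawn_pos v : drawn D (pos D v).
Proof. by left; exists v. Qed.

Lemma range_pos_finite : finite_set (range (pos D)).
Proof. exact/finite_image/finite_finset. Qed.

Lemma plane_accessible : accessible_space (R * R)%type.
Proof. exact/hausdorff_accessible/norm_hausdorff. Qed.

Lemma edge_paths_closed (E : set (edge G)) (a b : R) :
  closed (\bigcup_(e in E) (edge_path e @` `[a, b])).
Proof.
apply: closed_bigcup; first exact: finite_finset.
by move=> e _; apply: path_closed; exact: edge_path_continuous.
Qed.

Lemma drawnE : drawn D =
  range (pos D) `|` \bigcup_(e in setT) (edge_path e @` `[0, 1]).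
Proof.
rewrite /drawn; congr (_ `|` _); apply: eq_bigcupr => e _.
by apply: eq_imagel => t /=; rewrite in_itv /= => /edge_pathE ->.
Qed.

Lemma drawn_closed : closed (drawn D).
Proof.
rewrite drawnE; apply: closedU; last exact: edge_paths_closed.
exact: (accessible_finite_set_closed.1 plane_accessible) range_pos_finite.
Qed.

Variables (o : orientation G) (f : edge G -> 'Z_3).
Hypothesis flow : nowhere_zero_flow o f.

(** Turns of [e] around [x] in excess of the principal arguments at its ends. Off the drawing the
    quotient is an integer, which the floor merely reads off. *)
Definition winding x e : int :=
  Num.floor ((turn (edge_path e) 0 1 x - (argument (pos D (end1 e) - x) -
    argument (pos D (end0 e) - x))) / (pi *+ 2)).

Definition colour x : 'Z_3 := \sum_e signed_flow o f e *~ winding x e.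

Lemma windingE x e : ~ drawn D x ->
  turn (edge_path e) 0 1 x = argument (pos D (end1 e) - x) -
    argument (pos D (end0 e) - x) + (winding x e)%:~R * (pi *+ 2).
Proof.
move=> xD; rewrite /winding; set u := _ - _.
have [|m] := @turn_congr R (edge_path e) 0 1 x (@edge_path_continuous e) ler01.
  by move=> t _; apply/eqP => xE; apply: xD; rewrite -xE; exact: drawn_path.
rewrite edge_path0 edge_path1 -/u => uE.
rewrite uE mulfK ?gt_eqF ?pi2_gt0 // intrKfloor.
by rewrite -uE addrC subrK.
Qed.

(** Here [eta] is any real change of the arguments at the vertices. It is off by [j v] turns from
    the change of the principal arguments, and this potential contributes zero by
    [sum_potential]. *)
Lemma colour_diff x y (eta : vertex G -> R) (k : edge G -> int) :
  ~ drawn D x -> ~ drawn D y ->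
  (forall v, congr2pi (eta v) (argument (pos D v - y) - argument (pos D v - x))) ->
  (forall e, turn (edge_path e) 0 1 y = turn (edge_path e) 0 1 x +
     (eta (end1 e) - eta (end0 e)) + (k e)%:~R * (pi *+ 2)) ->
  colour y = colour x + \sum_e signed_flow o f e *~ k e.
Proof.
move=> xD yD eta_congr turnE; have [j jE] := choice eta_congr.
have windingD e : winding y e = winding x e + k e + (j (end1 e) - j (end0 e)).
  apply: (@intr_inj R); apply: (mulIf (lt0r_neq0 (@pi2_gt0 R))).
  have := turnE e; rewrite (windingE _ xD) (windingE _ yD).
  have := jE (end1 e); have := jE (end0 e).
  rewrite !rmorphD rmorphN /= !mulrDl mulNr; lra.
rewrite /colour; under eq_bigr do rewrite windingD mulrzDr [X in X + _]mulrzDr.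
by rewrite !big_split /= (sum_potential j flow) addr0.
Qed.

Lemma turn_ball x y (d : R) e : 0 < d -> (forall t, ~ ball x d (edge_path e t)) ->
  ball x (d / 2) y -> turn (edge_path e) 0 1 y = turn (edge_path e) 0 1 x +
    (angle (pos D (end1 e)) x y - angle (pos D (end0 e)) x y).
Proof.
move=> d0 xe yx; rewrite (turn_angle (@edge_path_continuous e) ler01 d0 _ yx) //.
by rewrite edge_path0 edge_path1 addrA.
Qed.

(** A small move changes each turn only by the angles at the ends of the edge, so [colour_diff]
    applies with [k] zero. *)
Lemma colour_near x : ~ drawn D x ->
  \forall y \near x, ~ drawn D y /\ colour y = colour x.
Proof.
move=> xD; have [d d0 dD] := closed_ball_out drawn_closed xD.
have : nbhs x (ball x (d / 2)) by apply: nbhsx_ballx; rewrite divr_gt0.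
have out z : drawn D z -> ~ ball x d z by move=> Dz /dD.
apply: filterS => y yx.
have yD : ~ drawn D y by apply: dD; apply: le_ball yx; lra.
split => //; have := @colour_diff x y (fun v => angle (pos D v) x y) (fun=> 0) xD yD.
under eq_bigr do rewrite mulr0z; rewrite big1 // addr0; apply.
  by move=> v; apply: angle_congr d0 _ yx; apply: out; exact: drawn_pos.
move=> e; rewrite mul0r addr0; apply: turn_ball d0 _ yx => t.
by apply: out; exact: drawn_path.
Qed.

(** By [colour_near] the points of one colour form a set that is open and closed in [C]. *)
Lemma colour_connected (C : set (R * R)) x y : connected C -> C `<=` ~` drawn D ->
  C x -> C y -> colour x = colour y.
Proof.
move=> cC CD Cx Cy.
have sub (u : 'Z_3 -> bool) : open [set z | ~ drawn D z /\ u (colour z)].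
  rewrite openE => z [zD uz]; have := colour_near zD; apply: filterS.
  by move=> w [wD wz] /=; rewrite wz.
have : C `&` [set z | colour z = colour x] = C.
  apply: cC; first by exists x.
    exists [set z | ~ drawn D z /\ colour z == colour x].
      exact: (sub (fun c => c == colour x)).
    apply/seteqP; split=> z [Cz].
      by move=> /= ->; split => //; split => //; exact: CD.
    by move=> [_ /eqP].
  exists (~` [set z | ~ drawn D z /\ colour z != colour x]).
    by apply: open_closedC; exact: (sub (fun c => c != colour x)).
  apply/seteqP; split=> z [Cz].
    by move=> /= ->; split => // -[_]; rewrite eqxx.
  move=> nz; split => //=; apply/eqP/negPn/negP => zx; apply: nz.
  by split => //; exact: CD.
by move=> CE; have [] : (C `&` [set z | colour z = colour x]) y by rewrite CE.
Qed.

End Colouring.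

(** * Regular points and the colour change across an edge *)

Section ColourChange.
Variables (R : realType) (G : multigraph) (D : drawing R G).
Implicit Types (e : edge G) (s t : R) (x y z : R * R).

Definition special : set (R * R) := range (pos D) `|`
  [set x | exists e s e' t, [/\ `[0, 1]%classic s, `[0, 1]%classic t,
    (e, s) <> (e', t), curve D e s = x & curve D e' t = x]].

Lemma special_finite : finite_set special.
Proof.
by rewrite finite_setU; split; [exact: range_pos_finite|exact: finite_crossings].
Qed.

Lemma special_pos v : special (pos D v). Proof. by left; exists v. Qed.

Lemma edge_path_inj e s e' t : 0 <= s <= 1 -> 0 <= t <= 1 ->
  edge_path D e s = edge_path D e' t -> ~ special (edge_path D e s) ->
  (e, s) = (e', t).
Proof.
move=> s01 t01 est ns; apply: contrapT => ne; apply: ns; right.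
by exists e, s, e', t; rewrite -!edge_pathE // /= !in_itv /= s01 t01.
Qed.

(** The segment is connected and has two distinct points, so it cannot lie in the finite set
    [special]. *)
Lemma edge_segment_regular S : edge_segment D S ->
  exists e t, [/\ 0 < t < 1, S (edge_path D e t) & ~ special (edge_path D e t)].
Proof.
move=> [e [a [b [a0 ab b1 SE neq]]]].
have in01 t : a <= t <= b -> 0 <= t <= 1.
  by move=> /andP[at_ tb]; rewrite (le_trans a0 at_) (le_trans tb b1).
have Spath t : a <= t <= b -> S (edge_path D e t).
  by move=> tab; rewrite SE edge_pathE ?in01 //; exists t => //=; rewrite in_itv.
have [t tab nt] : exists2 t, a <= t <= b & ~ special (edge_path D e t).
  apply: contrapT => all_special; apply: neq.
  have aab : a <= a <= b by rewrite lexx ltW.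
  have bab : a <= b <= b by rewrite lexx ltW.
  rewrite -!edge_pathE ?in01 //.
  apply: (@connected_finite _ (edge_path D e @` `[a, b]) special).
  - exact: plane_accessible.
  - apply: connected_continuous_connected; first exact: segment_connected.
    by apply: continuous_subspaceT; exact: edge_path_continuous.
  - exact: special_finite.
  - move=> _ [t /= + <-]; rewrite in_itv /= => tab.
    by apply: contrapT => nt; apply: all_special; exists t.
  - by exists a => //=; rewrite in_itv.
  - by exists b => //=; rewrite in_itv.
exists e, t; split; [|exact: Spath|exact: nt].
have /andP[t0 t1] := in01 _ tab; rewrite !lt_neqAle t0 t1 !andbT.
apply/andP; split; apply/eqP => tE; apply: nt;
  [rewrite -tE edge_path0|rewrite tE edge_path1];
  exact: special_pos.
Qed.

Variables (o : orientation G) (f : edge G -> 'Z_3).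
Hypothesis flow : nowhere_zero_flow o f.

(** Near a regular point [q] of the segment the drawing is an arc of a single edge [e]. Up to a
    potential, passing from [x1] to [x2] changes only the winding of [e], by a number [m] that
    [crossing_separated] shows not to be divisible by 3. *)
Lemma colour_change S U C1 C2 : edge_segment D S -> open U -> S `<=` U ->
  components (U `\` drawn D) C1 -> components (U `\` drawn D) C2 -> C1 <> C2 ->
  S `<=` closure C1 `&` closure C2 ->
  exists x1 x2, [/\ C1 x1, C2 x2 & colour D o f x1 <> colour D o f x2].
Proof.
move=> Sseg oU SU C1c C2c C12 SC.
have [e [c [c01 Sc nsc]]] := edge_segment_regular Sseg.
set p := edge_path D e; set q := p c.
have p_cont : continuous p by exact: edge_path_continuous.
have [r r0 rU] : exists2 r : R, 0 < r & ball q r `<=` U.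
  have /nbhs_ballP[r r0 rU] : nbhs q U.
    by apply: open_nbhs_nbhs; split => //; exact: SU.
  by exists r.
have [d d0 dP] : exists2 d : R, 0 < d & forall t, `|c - t| < d ->
    [/\ 0 < t < 1, ~ special (p t) & ball q r (p t)].
  have near1 : \forall t \near c, ~ special (p t).
    have : nbhs q (~` special).
      apply: open_nbhs_nbhs; split => //; apply: closed_openC.
      exact: (accessible_finite_set_closed.1 (@plane_accessible R)) special_finite.
    exact: p_cont.
  have near2 : \forall t \near c, ball q r (p t).
    have : nbhs q (ball q r) by exact: nbhsx_ballx.
    exact: p_cont.
  have near3 : \forall t \near c, t \in `]0, 1[.
    by apply: near_in_itvoo; rewrite in_itv.
  have [d d0 dP] := (nbhs_ballP _ _).1 (filterI near1 (filterI near2 near3)).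
  by exists d => // t /dP[? [?]]; rewrite in_itv.
pose a := c - d / 2; pose b := c + d / 2.
have ac : a < c by rewrite /a; lra.
have cb : c < b by rewrite /b; lra.
have abP t : a <= t <= b -> [/\ 0 < t < 1, ~ special (p t) & ball q r (p t)].
  rewrite /a /b => /andP[at_ tb]; apply: dP; rewrite ltr_norml.
  by apply/andP; split; lra.
have ab01 t : a <= t <= b -> 0 <= t <= 1.
  by move=> /abP[/andP[? ?] _ _]; rewrite !ltW.
have aab : a <= a <= b by rewrite lexx; lra.
have bab : a <= b <= b by rewrite lexx andbT; lra.
have cab : a <= c <= b by rewrite !ltW.
(* [P] holds everything drawn except the arc strictly between [a] and [b], and the outside of a ball
   contained in [U]. So the complement of [P] and the arc is part of U minus the drawing. *)
pose others := range (pos D) `|`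
  (\bigcup_(e' in [set e' | e' != e]) (edge_path D e' @` `[0, 1]) `|`
  (p @` `[0, a] `|` p @` `[b, 1])).
pose P := ~` ball q r `|` others.
have P_closed : closed P.
  apply: closedU; first by apply: open_closedC; exact: ball_open.
  apply: closedU; first exact: (accessible_finite_set_closed.1
    (@plane_accessible R)) (range_pos_finite D).
  apply: closedU; first exact: edge_paths_closed.
  by apply: closedU; exact: path_closed.
have P_ends t : a <= t <= b -> P (p t) -> t = a \/ t = b.
  move=> tab; have [t01 nst tr] := abP t tab; have t01' := ab01 t tab.
  have a01 := ab01 a aab; have b01 := ab01 b bab.
  move=> [//|[[v _ vt]|[[e' /= e'e [s /=]]|[[s /=]|[s /=]]]]].
  - by case: nst; rewrite -vt; exact: special_pos.
  - rewrite in_itv /= => s01 st.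
    have [ee _] := edge_path_inj t01' s01 (esym st) nst.
    by move: e'e; rewrite -ee eqxx.
  - rewrite in_itv /= => /andP[s0 sa] st; left.
    have s01 : 0 <= s <= 1 by move: a01 => /andP[? ?]; rewrite s0; lra.
    have [ts] := edge_path_inj t01' s01 (esym st) nst.
    by apply/le_anti; rewrite ts sa -ts; case/andP : tab.
  - rewrite in_itv /= => /andP[bs s1] st; right.
    have s01 : 0 <= s <= 1 by move: b01 => /andP[? ?]; rewrite s1 andbT; lra.
    have [ts] := edge_path_inj t01' s01 (esym st) nst.
    by apply/le_anti; rewrite ts bs -ts andbT; case/andP : tab.
have Pq : ~ P q by move=> /(P_ends _ cab) [|]; lra.
have [k k0 kP] := closed_ball_out P_closed Pq.
have P_far z : P z -> ~ ball q k z by move=> Pz /kP.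
have P_out z : ~ ball q r z -> P z by left.
have Pa : P (p a).
  right; right; right; left; exists a => //=.
  by rewrite in_itv /= lexx andbT; case/andP: (ab01 a aab).
have Pb : P (p b).
  right; right; right; right; exists b => //=.
  by rewrite in_itv /= lexx /=; case/andP: (ab01 b bab).
have p_inj s t : a <= s <= b -> a <= t <= b -> p s = p t -> s = t.
  move=> sab tab st; have [_ ns _] := abP s sab.
  by have [] := edge_path_inj (ab01 s sab) (ab01 t tab) st ns.
have drawn_P z : drawn D z -> P z \/ (p @` `[a, b]) z.
  rewrite drawnE => -[zv|[e' _ [t /= + <-]]]; first by left; right; left.
  rewrite in_itv /= => t01; have [e'e|e'e] := eqVneq e' e; last first.
    by left; right; right; left; exists e' => //; exists t => //=; rewrite in_itv.
  rewrite e'e -/p; have /andP[t0 t1] := t01.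
  have [ta|at_] := leP t a.
    by left; right; right; right; left; exists t => //=; rewrite in_itv /= t0.
  have [tb|bt] := leP t b; last first.
    by left; right; right; right; right; exists t => //=; rewrite in_itv /= ltW.
  by right; exists t => //=; rewrite in_itv /= tb ltW.
have pick C : components (U `\` drawn D) C -> closure C q ->
    exists2 x, C x & [/\ ~ drawn D x, ball q (k / 2) x,
      beside p a c b k x & C = connected_component (U `\` drawn D) x].
  move=> [u _ CE] /(_ (ball q (k / 2))) [|x [Cx xq]].
    by apply: nbhsx_ballx; rewrite divr_gt0.
  have [_ xD] : (U `\` drawn D) x.
    by apply: (@connected_component_sub _ _ u); rewrite CE.
  exists x => //; split => //; last first.
    by rewrite -CE; apply: same_connected_component; rewrite CE.
  split => // t _; apply/eqP => ptx; apply: xD; rewrite -ptx; exact: drawn_path.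
have [x1 C1x1 [x1D x1q x1b C1E]] := pick _ C1c (SC _ Sc).1.
have [x2 C2x2 [x2D x2q x2b C2E]] := pick _ C2c (SC _ Sc).2.
exists x1, x2; split => //.
have K_sub : ~` (P `|` p @` `[a, b]) `<=` U `\` drawn D.
  move=> z nKz; split.
    by apply: rU; apply: contrapT => /P_out Pz; apply: nKz; left.
  by move=> /drawn_P zK; apply: nKz.
(* A connected set off [P] and the arc avoids the drawing within [U], so it cannot join the distinct
   components [C1] and [C2]. *)
have sep : ~ connected_component (~` (P `|` p @` `[a, b])) x1 x2.
  move=> [B [Bx1 BK cB Bx2]]; apply: C12; rewrite C1E C2E.
  apply: same_connected_component; exists B => //.
  by split => //; exact: subset_trans K_sub.
have ncong := crossing_separated p_cont ac cb k0 p_inj P_closed r0 P_far P_out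
  Pa Pb P_ends x1b x2b sep.
have cong x : beside p a c b k x -> congr2pi (crossing p a c b x)
    (argument (p b - p c) - argument (p a - p c)).
  exact: crossing_congr p_cont ac cb k0 (P_far _ Pa) (P_far _ Pb) _.
have [m mE] := congr2pi_trans (cong _ x2b) (congr2pi_sym (cong _ x1b)).
have m3 : ~ (3 %| m)%Z.
  move=> /dvdzP[n nE]; apply: ncong; apply: congr2pi_sym; exists n.
  by rewrite -mulrBl mE nE rmorphM /=; field.
have pos_far v : ~ ball q k (pos D v) by apply: P_far; right; left; exists v.
have other_far e' t : e' != e -> ~ ball q k (edge_path D e' t).
  move=> e'e; apply: P_far; right; right; left; exists e' => //.
  exists (clamp 0 1 t); first by rewrite /= in_itv /= clamp_itv ?ler01.
  by rewrite edge_pathE ?clamp_itv ?ler01.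
have a0 : 0 <= a by case/andP: (ab01 a aab).
have b1 : b <= 1 by case/andP: (ab01 b bab).
(* The pieces before [a] and after [b] stay away from [q] and vary with [x] by the angles at their
   ends. Those at [p a] and [p b] are absorbed by [crossing]. *)
have turn_e x : ~ drawn D x -> ball q (k / 2) x -> turn p 0 1 x =
    turn p 0 a q + turn p b 1 q + crossing p a c b x +
    (angle (pos D (end1 e)) q x - angle (pos D (end0 e)) q x).
  move=> xD xq; have px t : p t != x.
    by apply/eqP => ptx; apply: xD; rewrite -ptx; exact: drawn_path.
  have aa : a <= 1 by lra.
  have ab : a <= b by lra.
  rewrite (@turn_cat _ p 0 a 1 x) // (@turn_cat _ p a b 1 x) //.
  rewrite (turn_angle p_cont a0 k0 _ xq); last first.
    move=> t tI; apply: P_far; right; right; right; left.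
    by exists t => //; rewrite /= in_itv.
  rewrite (turn_angle p_cont b1 k0 _ xq); last first.
    move=> t tI; apply: P_far; right; right; right; right.
    by exists t => //; rewrite /= in_itv.
  rewrite /p edge_path0 edge_path1 -/p /crossing -/q; ring.
pose eta v := angle (pos D v) q x2 - angle (pos D v) q x1.
pose ke e' := if e' == e then m else 0.
have -> : colour D o f x2 = colour D o f x1 + \sum_e' signed_flow o f e' *~ ke e'.
  apply: (colour_diff flow (eta := eta)) => // [v|e'].
    have A1 := angle_congr k0 (pos_far v) x1q.
    have A2 := angle_congr k0 (pos_far v) x2q.
    by have := congr2piB A2 A1; congr congr2pi; ring.
  rewrite /ke; case: eqVneq => [->|e'e].
    by rewrite -/p !turn_e // /eta -mE; ring.
  have far t := other_far e' t e'e.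
  rewrite (turn_ball k0 far x2q) (turn_ball k0 far x1q) /eta mul0r; ring.
rewrite (bigD1 e) //= [X in _ + (_ + X)]big1 => [|e' e'e]; last first.
  by rewrite /ke (negPf e'e) mulr0z.
(* Equal colours would make [signed_flow o f e *~ m] vanish in 'Z_3, so 3 would divide [m]. *)
rewrite addr0 {1}/ke eqxx => /esym/eqP; rewrite -subr_eq0 addrAC subrr add0r => /eqP.
by move=> /(Z3_mulrz_eq0 (signed_flow_neq0 _ flow)).
Qed.

End ColourChange.

(** * From points to faces *)

Theorem theorem5 (R : realType) (G : multigraph) :
  has_nowhere_zero_flow G 3 -> facially_colorable R 3 G.
Proof.
move=> [dir [f flow]] D.
(* A face takes the colour of one of its points, picked by [xget]; all its points agree, in
   particular those in the local pieces [C1] and [C2]. *)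
exists (fun F => colour D dir f (xget 0 F)) => F1 F2 F1f F2f.
move=> [S [U [C1 [C2 [Sseg oU SU [C1c C2c C12 [C1F C2F] SC]]]]]].
have [x1 [x2 [C1x C2x x12]]] := colour_change flow Sseg oU SU C1c C2c C12 SC.
have face_colour F x : faces D F -> F x -> colour D dir f (xget 0 F) = colour D dir f x.
  move=> [z _ FE] Fx; apply: (@colour_connected _ _ D dir f flow F) => //.
  - by rewrite -FE; exact: component_connected.
  - by rewrite -FE; exact: connected_component_sub.
  - by apply: (@xgetPex _ 0 F); exists x.
by rewrite (face_colour F1 x1 F1f (C1F _ C1x)) (face_colour F2 x2 F2f (C2F _ C2x)).
Qed.
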